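(* Let $m,n$ be positive integers with $mn>6$. For every entangled state $\rho$ on $\mathbb{C}^m\otimes\mathbb{C}^n$ there exists a nondecomposable entanglement witness $W$ on $\mathbb{C}^m\otimes\mathbb{C}^n$ with $\operatorname{tr}(W\rho)<0$.
   Context: A state is a positive semidefinite trace-one matrix; it is separable if it is a convex combination of product states $|v\rangle\langle v|\otimes|w\rangle\langle w|$, and entangled otherwise. The partial transpose is $M^\Gamma:=(T\otimes\mathrm{id})(M)$ with $T$ the transpose on the first factor. A Hermitian $W$ is an entanglement witness if $\langle a,b|W|a,b\rangle\ge0$ for all product vectors $|a\rangle\otimes|b\rangle$ and $W$ has at least one negative eigenvalue; it is decomposable if $W=P+Q^\Gamma$ with $P,Q$ positive semidefinite, and nondecomposable otherwise. *)

(* Defs.v *)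
From HB Require Import structures.
From mathcomp Require Import all_boot all_algebra.
From mathcomp Require Import complex reals.
Set Implicit Arguments. Unset Strict Implicit. Unset Printing Implicit Defensive.
Import GRing.Theory Num.Theory.
Local Open Scope ring_scope.

Section QuantumDefs.
Variable R : realType.
Notation C := (R[i]).

Definition adjmx (p q : nat) (A : 'M[C]_(p, q)) : 'M[C]_(q, p) :=
  (map_mx (@Num.Def.conjC C) A)^T.

Definition hermitian (N : nat) (A : 'M[C]_N) : Prop := A = adjmx A.

Definition psd (N : nat) (A : 'M[C]_N) : Prop :=
  hermitian A /\ forall v : 'cV[C]_N, 0 <= (adjmx v *m A *m v) 0 0.

Definition is_state (N : nat) (rho : 'M[C]_N) : Prop :=
  psd rho /\ \tr rho = 1.

(* index of C^m (x) C^n: k : 'I_(m*n) <-> (i, j), the ordering of mxvec_index *)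
Definition pidx (m n : nat) (k : 'I_(m * n)) : 'I_m * 'I_n :=
  enum_val (cast_ord (esym (mxvec_cast m n)) k).

Definition kron (m1 m2 n1 n2 : nat) (A : 'M[C]_(m1, m2)) (B : 'M[C]_(n1, n2))
  : 'M[C]_(m1 * n1, m2 * n2) :=
  \matrix_(k, l) (A (pidx k).1 (pidx l).1 * B (pidx k).2 (pidx l).2).

Definition prodvec (m n : nat) (a : 'cV[C]_m) (b : 'cV[C]_n) : 'cV[C]_(m * n) :=
  \col_k (a (pidx k).1 0 * b (pidx k).2 0).

Definition ptrans (m n : nat) (M : 'M[C]_(m * n)) : 'M[C]_(m * n) :=
  \matrix_(k, l) M (mxvec_index (pidx l).1 (pidx k).2)
                   (mxvec_index (pidx k).1 (pidx l).2).

Definition separable (m n : nat) (rho : 'M[C]_(m * n)) : Prop :=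
  exists (K : nat) (p : 'I_K -> C) (v : 'I_K -> 'cV[C]_m) (w : 'I_K -> 'cV[C]_n),
    [/\ forall t, 0 <= p t,
        \sum_(t < K) p t = 1,
        forall t, adjmx (v t) *m v t = 1%:M,
        forall t, adjmx (w t) *m w t = 1%:M &
        rho = \sum_(t < K) p t *: kron (v t *m adjmx (v t)) (w t *m adjmx (w t))].

Definition entangled (m n : nat) (rho : 'M[C]_(m * n)) : Prop :=
  is_state rho /\ ~ separable rho.

Definition ent_witness (m n : nat) (W : 'M[C]_(m * n)) : Prop :=
  [/\ hermitian W,
      forall (a : 'cV[C]_m) (b : 'cV[C]_n),
        0 <= (adjmx (prodvec a b) *m W *m prodvec a b) 0 0 &
      exists lam : C, lam < 0 /\ eigenvalue W lam].

Definition decomposable (m n : nat) (W : 'M[C]_(m * n)) : Prop :=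
  exists P Q : 'M[C]_(m * n), [/\ psd P, psd Q & W = P + ptrans Q].

End QuantumDefs.

(* Main.v *)
Require Import Defs.
From mathcomp Require Import all_boot all_algebra.
From mathcomp Require Import complex reals.
From mathcomp Require Import all_order.
From mathcomp Require Import boolp classical_sets topology normedtype derive.
From mathcomp Require Import ring lra zify.
Import GRing.Theory Num.Theory.
Import Order.TTheory numFieldTopology.Exports numFieldNormedType.Exports.
Local Open Scope ring_scope.

(** A state that is not separable is separated from the compact convex set of
    separable states by a block-positive W0 (nearest point; Caratheodory bounds
    the number of product terms, whence compactness).  If W0 = P + Q^Gamma is
    decomposable, then tr (Q rho^Gamma) < 0, so <psi| rho^Gamma |psi> < 0 for some
    psi, which has Schmidt rank at least 2.  Now take a PPT entangled state sigma
    with sigma^Gamma psi = 0 and a block-positive V with tr (V sigma) < 0.  For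
    large t the operator W = t |psi><psi|^Gamma + V satisfies tr (W rho) < 0, while
    tr (W sigma) = tr (V sigma) < 0 makes it nondecomposable.  Since mn > 6 and
    psi has rank at least 2, sigma can be transported by local filters from
    a 3x3, a 2x4 or a 4x2 state whose partial transpose kills
    sum_(i < r) e_i (x) e_i, with r the rank of psi, capped at 3 in the 3x3 case. *)

Set Implicit Arguments.
Unset Strict Implicit.
Unset Printing Implicit Defensive.

(* sesquilinear forms also define [hermitian]. *)
Local Notation hermitian := Defs.hermitian.
Local Notation Re := complex.Re.
Local Notation Im := complex.Im.

(** * Psd matrices and the tensor structure *)

Section LinearAlgebra.
Variable R : realType.
Notation C := R[i].
Notation cj := (@Num.Def.conjC C).
Implicit Types (m n p q : nat).

Lemma adjmxE p q (A : 'M[C]_(p, q)) i j : adjmx A i j = cj (A j i).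
Proof. by rewrite !mxE. Qed.

Lemma adjmxK p q (A : 'M[C]_(p, q)) : adjmx (adjmx A) = A.
Proof. by apply/matrixP=> i j; rewrite !adjmxE conjCK. Qed.

Lemma adjmxM p q r (A : 'M[C]_(p, q)) (B : 'M[C]_(q, r)) :
  adjmx (A *m B) = adjmx B *m adjmx A.
Proof. by rewrite /adjmx map_mxM trmx_mul. Qed.

Lemma adjmxD p q (A B : 'M[C]_(p, q)) : adjmx (A + B) = adjmx A + adjmx B.
Proof. by rewrite /adjmx map_mxD linearD. Qed.

Lemma adjmxZ p q c (A : 'M[C]_(p, q)) : adjmx (c *: A) = cj c *: adjmx A.
Proof. by rewrite /adjmx map_mxZ linearZ. Qed.

Lemma adjmx_sum p q I (r : seq I) (F : I -> 'M[C]_(p, q)) :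
  adjmx (\sum_(i <- r) F i) = \sum_(i <- r) adjmx (F i).
Proof. by rewrite /adjmx map_mx_sum linear_sum. Qed.

Lemma mxtrace_adjmx n (A : 'M[C]_n) : \tr (adjmx A) = cj (\tr A).
Proof. by rewrite mxtrace_tr /mxtrace rmorph_sum; apply: eq_bigr => i _; rewrite mxE. Qed.

Lemma quad_formE n (A : 'M[C]_n) (v : 'cV[C]_n) :
  (adjmx v *m A *m v) 0 0 = \tr (A *m (v *m adjmx v)).
Proof. by rewrite mulmxA -mxtrace_mulC mulmxA trace_mx11. Qed.

Lemma hermitianD n (A B : 'M[C]_n) : hermitian A -> hermitian B -> hermitian (A + B).
Proof. by rewrite /Defs.hermitian adjmxD => <- <-. Qed.

Lemma hermitianZ n c (A : 'M[C]_n) :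
  c \is Num.real -> hermitian A -> hermitian (c *: A).
Proof. by rewrite /Defs.hermitian adjmxZ => /CrealP -> <-. Qed.

Lemma hermitian_rank1 n (v : 'cV[C]_n) : hermitian (v *m adjmx v).
Proof. by rewrite /Defs.hermitian adjmxM adjmxK. Qed.

Lemma hermitian_congr n p (A : 'M[C]_n) (B : 'M[C]_(p, n)) :
  hermitian A -> hermitian (B *m A *m adjmx B).
Proof. by rewrite /Defs.hermitian !adjmxM adjmxK mulmxA => <-. Qed.

Lemma quad_form_rank1 N (z v : 'cV[C]_N) :
  (adjmx z *m (v *m adjmx v) *m z) 0 0 = `|(adjmx z *m v) 0 0| ^+ 2.
Proof.
rewrite mulmxA -mulmxA -[adjmx v *m z]adjmxK adjmxM adjmxK.
by rewrite mxE big_ord1 adjmxE -normCK.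
Qed.

Lemma psd_rank1 n (v : 'cV[C]_n) : psd (v *m adjmx v).
Proof.
split=> [|u]; first exact: hermitian_rank1.
by rewrite quad_form_rank1 exprn_ge0.
Qed.

Lemma psdD n (A B : 'M[C]_n) : psd A -> psd B -> psd (A + B).
Proof.
move=> [hA pA] [hB pB]; split=> [|v]; first exact: hermitianD.
by rewrite mulmxDr mulmxDl mxE addr_ge0.
Qed.

Lemma psd0 n : psd (0 : 'M[C]_n).
Proof.
split=> [|v]; first by rewrite /Defs.hermitian /adjmx map_mx0 trmx0.
by rewrite mulmx0 mul0mx mxE.
Qed.

Lemma psd_sum n I (r : seq I) (F : I -> 'M[C]_n) :
  (forall i, psd (F i)) -> psd (\sum_(i <- r) F i).
Proof. by move=> pF; elim/big_ind: _ => //; [exact: psd0|exact: psdD]. Qed.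

Lemma psd_congr n p (A : 'M[C]_n) (B : 'M[C]_(p, n)) :
  psd A -> psd (B *m A *m adjmx B).
Proof.
move=> [hA pA]; split=> [|v]; first exact: hermitian_congr.
by have := pA (adjmx B *m v); rewrite adjmxM adjmxK !mulmxA.
Qed.

Lemma hermitian_quad_real n (A : 'M[C]_n) (v : 'cV[C]_n) :
  hermitian A -> (adjmx v *m A *m v) 0 0 \is Num.real.
Proof.
move=> hA; apply/CrealP.
by rewrite -(adjmxE (adjmx v *m A *m v)) !adjmxM adjmxK -hA mulmxA.
Qed.

(** The vectors are the adjoints of the rows of a unitary that diagonalizes [W], so a trace against
    [W] becomes a sum of quadratic forms weighted by eigenvalues. [eigenvalue] concerns row vectors,
    hence the rows themselves are the eigenvectors. *)
Lemma spectral_trace n (W : 'M[C]_n) : hermitian W ->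
  exists (d : 'I_n -> C) (v : 'I_n -> 'cV[C]_n),
  [/\ forall i, d i \is Num.real, forall i, d i = (adjmx (v i) *m W *m v i) 0 0,
      forall i, eigenvalue W (d i) &
      forall Q, \tr (W *m Q) = \sum_i d i * (adjmx (v i) *m Q *m v i) 0 0].
Proof.
move=> hW; have Wn : W \is hermsymmx.
  by apply/is_hermitianmxP; rewrite expr0 scale1r -map_trmx.
have := hermitian_normalmx Wn => /orthomx_spectralP.
have := spectral_unitarymx W.
move: (spectralmx W) (spectral_diag W) => P d Pu WE.
 have PV : invmx P = adjmx P by rewrite invmx_unitary// /adjmx map_trmx.
have PPV : P *m adjmx P = 1%:M by rewrite -PV mulmxV// unitarymx_unit.
have PdW : P *m W *m adjmx P = diag_mx d.
  by rewrite {1}WE PV !mulmxA PPV mul1mx -mulmxA PPV mulmx1.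
have qE Q i : (adjmx (adjmx (row i P)) *m Q *m adjmx (row i P)) 0 0 =
    (P *m Q *m adjmx P) i i.
  rewrite adjmxK -row_mul mxE [RHS]mxE; apply: eq_bigr => j _.
  by rewrite !adjmxE !mxE.
have dE i : d 0 i = (adjmx (adjmx (row i P)) *m W *m adjmx (row i P)) 0 0.
  by rewrite qE PdW mxE eqxx mulr1n.
exists (fun i => d 0 i), (fun i => adjmx (row i P)); split=> //.
- by move=> i; rewrite dE; exact: hermitian_quad_real.
- move=> i; apply/eigenvalueP; exists (row i P).
    by rewrite -row_mul WE PV !mulmxA PPV mul1mx row_mul row_diag_mx -scalemxAl -rowE.
  apply/eqP => r0; have /matrixP/(_ i i) := PPV.
  have /rowP r0' := r0.
  by rewrite mxE big1 => [|j _]; [rewrite mxE eqxx => /eqP; rewrite eq_sym oner_eq0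
    | have := r0' j; rewrite !mxE => ->; rewrite mul0r].
- move=> Q; rewrite WE PV -!mulmxA mxtrace_mulC -!mulmxA /mxtrace.
  by apply: eq_bigr => i _; rewrite qE mul_diag_mx mxE !mulmxA.
Qed.

(** In the eigenbasis the trace is a combination of the eigenvalues with nonnegative coefficients,
    so one eigenvalue is negative. It is also given as a value of the quadratic form, which later
    supplies the vector psi. *)
Lemma trace_neg_eigenvalue n (W Q : 'M[C]_n) :
  hermitian W -> psd Q -> \tr (W *m Q) < 0 ->
  exists d (v : 'cV[C]_n), [/\ d < 0, d = (adjmx v *m W *m v) 0 0 & eigenvalue W d].
Proof.
move=> hW [_ pQ]; have [d [v [dr dq de ->]]] := spectral_trace hW => neg.
have [i di|nd] := pickP (fun i => d i < 0); first by exists (d i), (v i); split.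
suff s0 : 0 <= \sum_i d i * (adjmx (v i) *m Q *m v i) 0 0.
  by move: (le_lt_trans s0 neg); rewrite ltxx.
apply: sumr_ge0 => i _; apply: mulr_ge0; last exact: pQ.
by rewrite real_leNgt ?nd.
Qed.

Lemma psd_trace_ge0 n (P Q : 'M[C]_n) : psd P -> psd Q -> 0 <= \tr (P *m Q).
Proof.
move=> [hP pP] [_ pQ]; have [d [v [_ dq _ ->]]] := spectral_trace hP.
by apply: sumr_ge0 => i _; rewrite mulr_ge0// dq.
Qed.

Lemma pidxK m n (i : 'I_m) (j : 'I_n) : pidx (mxvec_index i j) = (i, j).
Proof. by rewrite /pidx /mxvec_index cast_ordK enum_rankK. Qed.

Lemma mxvec_index_pidx m n (k : 'I_(m * n)) :
  mxvec_index (pidx k).1 (pidx k).2 = k.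
Proof. by rewrite /pidx /mxvec_index -surjective_pairing enum_valK cast_ordKV. Qed.

Lemma sum_pidx m n (F : 'I_(m * n) -> C) :
  \sum_k F k = \sum_i \sum_j F (mxvec_index i j).
Proof.
rewrite pair_bigA /= (reindex (fun x : 'I_m * 'I_n => mxvec_index x.1 x.2)) //=.
by exists (@pidx m n) => x _; rewrite ?pidxK ?mxvec_index_pidx -?surjective_pairing.
Qed.

(** Under this identification product vectors are matrices of rank at most 1, and Schmidt rank is
    matrix rank. *)
Definition vecm m n (M : 'M[C]_(m, n)) : 'cV[C]_(m * n) :=
  \col_k M (pidx k).1 (pidx k).2.

Definition unvecm m n (v : 'cV[C]_(m * n)) : 'M[C]_(m, n) :=
  \matrix_(i, j) v (mxvec_index i j) 0.

Lemma unvecmK m n (v : 'cV[C]_(m * n)) : vecm (unvecm v) = v.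
Proof. by apply/colP=> k; rewrite !mxE mxvec_index_pidx. Qed.

Lemma prodvecE m n (a : 'cV[C]_m) (b : 'cV[C]_n) : prodvec a b = vecm (a *m b^T).
Proof. by apply/colP=> k; rewrite !mxE big_ord1 !mxE. Qed.

Lemma kron_vecm m1 m2 n1 n2 (A : 'M[C]_(m1, m2)) (B : 'M[C]_(n1, n2)) M :
  kron A B *m vecm M = vecm (A *m M *m B^T).
Proof.
apply/colP=> k; rewrite !mxE sum_pidx exchange_big /=; apply: eq_bigr => j _.
rewrite !mxE big_distrl /=; apply: eq_bigr => i _.
by rewrite !mxE pidxK /= mulrAC.
Qed.

Lemma kronM m1 m2 m3 n1 n2 n3 (A : 'M[C]_(m1, m2)) (B : 'M[C]_(n1, n2))
    (A' : 'M[C]_(m2, m3)) (B' : 'M[C]_(n2, n3)) :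
  kron A B *m kron A' B' = kron (A *m A') (B *m B').
Proof.
apply/matrixP=> k l; rewrite !mxE sum_pidx big_distrl /=; apply: eq_bigr => i _.
rewrite big_distrr /=; apply: eq_bigr => j _.
by rewrite !mxE pidxK /= mulrACA.
Qed.

Lemma adjmx_kron m1 m2 n1 n2 (A : 'M[C]_(m1, m2)) (B : 'M[C]_(n1, n2)) :
  adjmx (kron A B) = kron (adjmx A) (adjmx B).
Proof. by apply/matrixP=> k l; rewrite !mxE rmorphM. Qed.

Lemma kron1 m n : kron 1%:M 1%:M = 1%:M :> 'M[C]_(m * n).
Proof.
apply/matrixP=> k l; rewrite !mxE -natrM mulnb.
suff -> : (k == l) = ((pidx k).1 == (pidx l).1) && ((pidx k).2 == (pidx l).2) by [].
apply/eqP/andP => [->//|[/eqP e1 /eqP e2]].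
by rewrite -(mxvec_index_pidx k) e1 e2 mxvec_index_pidx.
Qed.

Lemma kron_prodvec m1 m2 n1 n2 (A : 'M[C]_(m1, m2)) (B : 'M[C]_(n1, n2)) a b :
  kron A B *m prodvec a b = prodvec (A *m a) (B *m b).
Proof. by rewrite !prodvecE kron_vecm trmx_mul !mulmxA. Qed.

Lemma kron_rank1 m n (a : 'cV[C]_m) (b : 'cV[C]_n) :
  kron (a *m adjmx a) (b *m adjmx b) = prodvec a b *m adjmx (prodvec a b).
Proof.
apply/matrixP=> k l; rewrite !mxE !big_ord1 !mxE rmorphM; ring.
Qed.

Lemma ptransE m n (M : 'M[C]_(m * n)) i j i' j' :
  ptrans M (mxvec_index i j) (mxvec_index i' j') =
  M (mxvec_index i' j) (mxvec_index i j').
Proof. by rewrite mxE !pidxK. Qed.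

Lemma eq_mx_pidx m n (A B : 'M[C]_(m * n)) :
  (forall i j i' j', A (mxvec_index i j) (mxvec_index i' j') =
     B (mxvec_index i j) (mxvec_index i' j')) -> A = B.
Proof.
move=> AB; apply/matrixP=> k l.
by rewrite -(mxvec_index_pidx k) -(mxvec_index_pidx l).
Qed.

Lemma ptransZ m n c (M : 'M[C]_(m * n)) : ptrans (c *: M) = c *: ptrans M.
Proof. by apply/matrixP=> k l; rewrite !mxE. Qed.

Lemma hermitian_ptrans m n (M : 'M[C]_(m * n)) : hermitian M -> hermitian (ptrans M).
Proof.
move=> hM; apply: eq_mx_pidx => i j i' j'.
by rewrite adjmxE !ptransE {1}hM adjmxE.
Qed.

Lemma mxtrace_ptrans m n (M N : 'M[C]_(m * n)) :
  \tr (ptrans M *m N) = \tr (M *m ptrans N).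
Proof.
have trE (A B : 'M[C]_(m * n)) : \tr (A *m B) = \sum_i \sum_j \sum_i' \sum_j'
   A (mxvec_index i j) (mxvec_index i' j') * B (mxvec_index i' j') (mxvec_index i j).
  rewrite /mxtrace sum_pidx; apply: eq_bigr => i _; apply: eq_bigr => j _.
  by rewrite mxE sum_pidx.
rewrite !trE [RHS]exchange_big [LHS]exchange_big /=; apply: eq_bigr => j _.
rewrite exchange_big /=; apply: eq_bigr => i _; apply: eq_bigr => i' _.
by apply: eq_bigr => j' _; rewrite !ptransE.
Qed.

(** The transpose of a projector-like [a *m adjmx a] is the same expression for the conjugate of
    [a]. *)
Lemma ptrans_rank1 m n (a : 'cV[C]_m) (b : 'cV[C]_n) :
  ptrans (prodvec a b *m adjmx (prodvec a b)) =
  prodvec (map_mx cj a) b *m adjmx (prodvec (map_mx cj a) b).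
Proof.
apply: eq_mx_pidx => i j i' j'; rewrite ptransE !mxE !big_ord1 !mxE !pidxK /=.
rewrite !rmorphM /= conjCK; ring.
Qed.

(** Local filters commute with the partial transpose once the first filter is conjugated, so they
    preserve the PPT property. *)
Lemma ptrans_congr m n p q (X : 'M[C]_(p * q)) (A : 'M[C]_(m, p)) (B : 'M[C]_(n, q)) :
  ptrans (kron A B *m X *m adjmx (kron A B)) =
  kron (map_mx cj A) B *m ptrans X *m adjmx (kron (map_mx cj A) B).
Proof.
have cE (A' : 'M[C]_(m, p)) Y i j i' j' :
    (kron A' B *m Y *m adjmx (kron A' B)) (mxvec_index i j) (mxvec_index i' j') =
    \sum_k \sum_l \sum_k' \sum_l'
      A' i k * B j l * Y (mxvec_index k l) (mxvec_index k' l') * cj (A' i' k' * B j' l').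
  rewrite -mulmxA mxE sum_pidx; apply: eq_bigr => k _; apply: eq_bigr => l _.
  rewrite [X in _ * X]mxE sum_pidx big_distrr /=; apply: eq_bigr => k' _.
  rewrite big_distrr /=; apply: eq_bigr => l' _.
  by rewrite !adjmxE !mxE !pidxK /= !mulrA.
apply: eq_mx_pidx => i j i' j'; rewrite ptransE !cE.
under eq_bigr do rewrite exchange_big.
under [RHS]eq_bigr do rewrite exchange_big.
rewrite exchange_big /=; apply: eq_bigr => k _; apply: eq_bigr => k' _.
apply: eq_bigr => l _; apply: eq_bigr => l' _.
rewrite ptransE !mxE !rmorphM /= conjCK; ring.
Qed.

End LinearAlgebra.

(** * Caratheodory reduction *)

Section Caratheodory.
Local Open Scope complex_scope.
Variable R : realType.
Notation C := R[i].

(** More matrices than the dimension N * N admit a complex linear relation. Taking adjoints shows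
    that the conjugate coefficients also form a relation, so the real parts and the imaginary parts
    do as well. One of the two families is nonzero, and a change of sign gives it a positive
    member. *)
Lemma hermitian_dependent N K (X : 'I_K.+1 -> 'M[C]_N) : (N * N <= K)%N ->
  (forall t, hermitian (X t)) ->
  exists c : 'I_K.+1 -> R, (exists t, 0 < c t) /\ \sum_t (c t)%:C *: X t = 0.
Proof.
move=> NK hX.
suff [c [[t ct] sc]] : exists c : 'I_K.+1 -> R,
    (exists t, c t != 0) /\ \sum_t (c t)%:C *: X t = 0.
  have [ct0|ct0|ct0] := ltrgtP 0 (c t); last by rewrite -ct0 eqxx in ct.
    by exists c; split => //; exists t.
  exists (fun t => - c t); split; first by exists t; rewrite oppr_gt0.
  rewrite -[RHS]oppr0 -[in RHS]sc -sumrN; apply: eq_bigr => i _.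
  by rewrite rmorphN scaleNr.
pose M := \matrix_t mxvec (X t).
have rM : kermx M != 0.
  rewrite -mxrank_eq0 mxrank_ker -lt0n subn_gt0.
  by rewrite (leq_ltn_trans (rank_leq_col M)) // ltnS.
have [i /eqP/rowV0Pn[c cM c0]] : exists i, row i (kermx M) <> 0.
  case: (pickP (fun i => row i (kermx M) != 0)) => [i /eqP ?|z]; first by exists i.
  case/eqP: rM; apply/row_matrixP => i; rewrite row0.
  by apply/eqP; move: (z i) => /negbFE.
have {}cM : c *m M = 0.
  by apply/sub_kermxP; apply: submx_trans cM (row_sub _ _).
have sc : \sum_t c 0 t *: X t = 0.
  apply: (can_inj mxvecK); rewrite linear0 -[RHS]cM linear_sum /=.
  by rewrite mulmx_sum_row; apply: eq_bigr => t _; rewrite linearZ rowK.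
have sc' : \sum_t (c 0 t)^* *: X t = 0.
  have : adjmx (\sum_t c 0 t *: X t) = 0 by rewrite sc /adjmx map_mx0 trmx0.
  rewrite adjmx_sum => s0; rewrite -[RHS]s0; apply: eq_bigr => t _.
  by rewrite adjmxZ -hX.
have /rV0Pn[t ct] := c0.
have [Rct|Rct] := eqVneq (complex.Re (c 0 t)) 0; last first.
  exists (fun t => complex.Re (c 0 t)); split; first by exists t.
  transitivity (2^-1 *: (\sum_t c 0 t *: X t + \sum_t (c 0 t)^* *: X t)); last first.
    by rewrite sc sc' addr0 scaler0.
  rewrite -big_split scaler_sumr /=; apply: eq_bigr => u _.
  by rewrite -scalerDl scalerA ReJ_add mulrC.
exists (fun t => complex.Im (c 0 t)); split.
  exists t; apply: contra ct => /eqP It; rewrite eq_complex Rct It !eqxx //.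
transitivity ((2^-1 * 'i%C) *: (\sum_t (c 0 t)^* *: X t - \sum_t c 0 t *: X t)).
  rewrite -sumrB scaler_sumr /=; apply: eq_bigr => u _.
  by rewrite -scalerBl scalerA ImJ_sub; congr (_ *: _); rewrite [RHS]mulrC mulrA.
by rewrite sc sc' subr0 scaler0.
Qed.

(** The weights move along a real dependency until the first of them reaches zero; this is the index
    minimizing p t / c t among those with c t > 0. *)
Lemma caratheodory_step N K (X : 'I_K.+1 -> 'M[C]_N) (p : 'I_K.+1 -> R) :
  (N * N <= K)%N -> (forall t, hermitian (X t)) -> (forall t, 0 <= p t) ->
  exists (s : 'I_K.+1) (q : 'I_K.+1 -> R), [/\ forall t, 0 <= q t, q s = 0 &
    \sum_t (q t)%:C *: X t = \sum_t (p t)%:C *: X t].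
Proof.
move=> NK hX p0; have [c [[t0 ct0] sc]] := hermitian_dependent NK hX.
case: (@Order.TotalTheory.arg_minP _ _ _ t0 (fun t => 0 < c t)
  (fun t => p t / c t) ct0) => s cs smin.
exists s, (fun t => p t - p s / c s * c t); split.
- move=> t; rewrite subr_ge0; have [ct|ct] := ltP 0 (c t).
    by rewrite -ler_pdivlMr// smin.
  apply: le_trans (p0 t); apply: mulr_ge0_le0 => //.
  by rewrite divr_ge0// ltW.
- by rewrite divfK ?subrr// gt_eqF.
- under eq_bigr do rewrite rmorphB rmorphM /= scalerBl -scalerA.
  by rewrite sumrB -scaler_sumr sc scaler0 subr0.
Qed.

Definition unitvec n (v : 'cV[C]_n) := adjmx v *m v = 1%:M.

Definition prodproj m n (v : 'cV[C]_m) (w : 'cV[C]_n) :=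
  kron (v *m adjmx v) (w *m adjmx w).

Lemma hermitian_prodproj m n (v : 'cV[C]_m) (w : 'cV[C]_n) :
  hermitian (prodproj v w).
Proof. by rewrite /prodproj kron_rank1; exact: hermitian_rank1. Qed.

Lemma mxtrace_kron m n (A : 'M[C]_m) (B : 'M[C]_n) :
  \tr (kron A B) = \tr A * \tr B.
Proof.
rewrite /mxtrace sum_pidx big_distrl /=; apply: eq_bigr => i _.
by rewrite big_distrr /=; apply: eq_bigr => j _; rewrite !mxE !pidxK.
Qed.

Lemma mxtrace_prodproj m n (v : 'cV[C]_m) (w : 'cV[C]_n) :
  unitvec v -> unitvec w -> \tr (prodproj v w) = 1.
Proof.
move=> hv hw; rewrite mxtrace_kron mxtrace_mulC hv (mxtrace_mulC w) hw.
by rewrite !mxtrace1 mulr1.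
Qed.

(** The number of terms is fixed and the weights are real, so that the decompositions are points of
    a finite-dimensional real space. *)
Definition sep_length m n K (rho : 'M[C]_(m * n)) :=
  exists (p : 'I_K -> R) (v : 'I_K -> 'cV[C]_m) (w : 'I_K -> 'cV[C]_n),
    [/\ forall t, 0 <= p t, \sum_t p t = 1, forall t, unitvec (v t),
        forall t, unitvec (w t) &
        rho = \sum_t (p t)%:C *: prodproj (v t) (w t)].

Lemma sep_length_separable m n K (rho : 'M[C]_(m * n)) :
  sep_length K rho -> separable rho.
Proof.
move=> [p [v [w [p0 p1 hv hw ->]]]]; exists K, (fun t => (p t)%:C), v, w.
by split=> //; [move=> t; rewrite ler0c | rewrite -rmorph_sum p1].
Qed.

(** Product projectors have trace 1, so equality of the two sums preserves the total weight; the
    term of weight zero is then dropped. *)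
Lemma sep_length_pred m n K (rho : 'M[C]_(m * n)) :
  (m * n * (m * n) <= K)%N -> sep_length K.+1 rho -> sep_length K rho.
Proof.
move=> NK [p [v [w [p0 p1 hv hw ->]]]].
have [s [q [q0 qs qE]]] :=
  caratheodory_step NK (fun t => hermitian_prodproj (v t) (w t)) p0.
have q1 : \sum_t q t = 1.
  apply: complexI; rewrite -p1 !rmorph_sum /=.
  have := congr1 (@mxtrace _ _) qE; rewrite !raddf_sum /=.
  under eq_bigr do rewrite mxtraceZ mxtrace_prodproj // mulr1.
  by under [X in _ = X -> _]eq_bigr do rewrite mxtraceZ mxtrace_prodproj // mulr1.
exists (q \o lift s), (v \o lift s), (w \o lift s); split=> //=.
- by rewrite -q1 [RHS](bigD1_ord s) //= qs add0r.
- by rewrite -qE [LHS](bigD1_ord s) //= qs scale0r add0r.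
Qed.

End Caratheodory.

(** * Compactness of bounded-length separable decompositions *)

Section Compactness.
Local Open Scope complex_scope.
Local Open Scope classical_set_scope.
Variable R : realType.
Notation C := R[i].
Notation cj := (@Num.Def.conjC C).

(** The constraint set is an intersection of preimages of a point, hence closed; being bounded it is
    compact, and the extreme value theorem applies. *)
Lemma min_on_bounded_variety D (I : Type) (f : 'rV[R]_D -> R)
    (g : I -> 'rV[R]_D -> R) (M : R) :
  continuous f -> (forall i, continuous (g i)) ->
  (forall x, (forall i, g i x = 1) -> forall j, `|x 0 j| <= M) ->
  (exists x, forall i, g i x = 1) ->
  exists x, (forall i, g i x = 1) /\ forall y, (forall i, g i y = 1) -> f x <= f y.
Proof.
move=> cf cg bg [x0 gx0]; pose V := [set x | forall i, g i x = 1].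
have VE : V = \bigcap_(i in [set: I]) (g i @^-1` [set y | y = 1]).
  by apply/seteqP; split=> x /= Vx i; [move=> _; apply: Vx|apply: Vx].
have Vcl : closed V.
  rewrite VE; apply: closed_bigI => i _.
  by apply: preimage_closed; [move=> x _; exact: cg|exact: closed_eq].
have Vb : bounded_set V.
  exists (Num.max M 0); split; first exact: num_real.
  move=> N MN x Vx; rewrite /Num.norm /= mx_normrE.
  apply/bigmax_leP; split=> [|[i j] _ /=].
    by apply: ltW; apply: le_lt_trans MN; rewrite le_max lexx orbT.
  rewrite ord1; apply: (le_trans (bg x Vx j)); apply: ltW.
  by apply: le_lt_trans MN; rewrite le_max lexx.
have V0 : V !=set0 by exists x0.
have [x xV xm] := EVT_min_rV V0 (bounded_closed_compact Vb Vcl)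
  (continuous_subspaceT cf).
exists x; split; first by rewrite inE in xV.
by move=> y Vy; apply: xm; rewrite inE.
Qed.

(** Continuity is tested on real and imaginary parts, since the minimized function and the
    constraints are real. *)
Definition ccont (T : topologicalType) (f : T -> C) :=
  continuous (fun x => Re (f x)) /\ continuous (fun x => Im (f x)).

Section Ccont.
Variable T : topologicalType.
Implicit Types f g : T -> C.

Lemma ccont_cst c : ccont (fun _ : T => c).
Proof. by split => x; exact: cvg_cst. Qed.

Lemma ccontD f g : ccont f -> ccont g -> ccont (fun x => f x + g x).
Proof.
move=> [f1 f2] [g1 g2]; split=> x.
  rewrite (_ : (fun x => _) = (fun x => Re (f x)) \+ (fun x => Re (g x))).
    by apply: (@continuousD _ R^o); [apply: f1|apply: g1].
  by apply/funext => y /=; case: (f y) (g y) => [a b] [c d].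
rewrite (_ : (fun x => _) = (fun x => Im (f x)) \+ (fun x => Im (g x))).
  by apply: (@continuousD _ R^o); [apply: f2|apply: g2].
by apply/funext => y /=; case: (f y) (g y) => [a b] [c d].
Qed.

Lemma ccontM f g : ccont f -> ccont g -> ccont (fun x => f x * g x).
Proof.
move=> [f1 f2] [g1 g2]; split=> x.
  rewrite (_ : (fun x => _) = (fun x => Re (f x)) \* (fun x => Re (g x)) \-
     (fun x => Im (f x)) \* (fun x => Im (g x))).
    apply: (@continuousB _ R^o); apply: continuousM;
      [apply: f1|apply: g1|apply: f2|apply: g2].
  by apply/funext => y /=; case: (f y) (g y) => [a b] [c d].
rewrite (_ : (fun x => _) = (fun x => Re (f x)) \* (fun x => Im (g x)) \+
     (fun x => Im (f x)) \* (fun x => Re (g x))).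
  apply: (@continuousD _ R^o); apply: continuousM;
      [apply: f1|apply: g2|apply: f2|apply: g1].
by apply/funext => y /=; case: (f y) (g y) => [a b] [c d].
Qed.

Lemma ccont_conj f : ccont f -> ccont (fun x => cj (f x)).
Proof.
move=> [f1 f2]; split=> x.
  rewrite (_ : (fun x => _) = (fun x => Re (f x))); first exact: f1.
  by apply/funext => y /=; case: (f y) => [a b].
rewrite (_ : (fun x => _) = \- (fun x => Im (f x))).
  by apply: (@continuousN _ R^o); exact: f2.
by apply/funext => y /=; case: (f y) => [a b].
Qed.

Lemma ccont_sum (I : Type) (r : seq I) (F : I -> T -> C) :
  (forall i, ccont (F i)) -> ccont (fun x => \sum_(i <- r) F i x).
Proof.
move=> cF; elim: r => [|i r IH].
  under eq_fun do rewrite big_nil; exact: ccont_cst.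
by under eq_fun do rewrite big_cons; exact: ccontD.
Qed.

Definition mxcont p q (F : T -> 'M[C]_(p, q)) :=
  forall i j, ccont (fun x => F x i j).

Lemma mxcontM p q r (F : T -> 'M[C]_(p, q)) (G : T -> 'M[C]_(q, r)) :
  mxcont F -> mxcont G -> mxcont (fun x => F x *m G x).
Proof.
move=> cF cG i j; under eq_fun do rewrite mxE.
by apply: ccont_sum => k; apply: ccontM; [apply: cF|apply: cG].
Qed.

Lemma mxcont_adj p q (F : T -> 'M[C]_(p, q)) :
  mxcont F -> mxcont (fun x => adjmx (F x)).
Proof. by move=> cF i j; under eq_fun do rewrite adjmxE; apply: ccont_conj. Qed.

Lemma mxcont_kron p q p' q' (F : T -> 'M[C]_(p, q)) (G : T -> 'M[C]_(p', q')) :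
  mxcont F -> mxcont G -> mxcont (fun x => kron (F x) (G x)).
Proof. by move=> cF cG i j; under eq_fun do rewrite mxE; apply: ccontM. Qed.

Lemma mxcontZ p q (f : T -> C) (G : T -> 'M[C]_(p, q)) :
  ccont f -> mxcont G -> mxcont (fun x => f x *: G x).
Proof. by move=> cf cG i j; under eq_fun do rewrite mxE; apply: ccontM. Qed.

Lemma mxcontB p q (F G : T -> 'M[C]_(p, q)) :
  mxcont F -> mxcont G -> mxcont (fun x => F x - G x).
Proof.
move=> cF cG i j; under eq_fun do rewrite !mxE -mulN1r.
apply: ccontD => //; apply: ccontM => //; exact: ccont_cst.
Qed.

Lemma mxcont_sum p q (I : Type) (r : seq I) (F : I -> T -> 'M[C]_(p, q)) :
  (forall i, mxcont (F i)) -> mxcont (fun x => \sum_(i <- r) F i x).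
Proof.
by move=> cF i j; under eq_fun do rewrite summxE; apply: ccont_sum => k; apply: cF.
Qed.

Lemma ccont_trace p (F : T -> 'M[C]_p) : mxcont F -> ccont (fun x => \tr (F x)).
Proof. by move=> cF; apply: ccont_sum => i; apply: cF. Qed.

End Ccont.

Section Parametrization.
Variables m n K : nat.

(** One real coordinate per weight, and two per vector component: [true] marks the real part,
    [false] the imaginary part. *)
Definition sep_idx : finType := ('I_K + ('I_K * 'I_m * bool + 'I_K * 'I_n * bool))%type.

Notation pt := 'rV[R]_#|sep_idx|.

Definition sep_coord (x : pt) (j : sep_idx) : R := x 0 (enum_rank j).

(* Weights are squared coordinates, so that no sign constraint is needed. *)
Definition sep_wt (x : pt) t : R := sep_coord x (inl t) ^+ 2.

Definition sep_v (x : pt) t : 'cV[C]_m :=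
  \col_i (sep_coord x (inr (inl (t, i, true))) +i* sep_coord x (inr (inl (t, i, false)))).

Definition sep_w (x : pt) t : 'cV[C]_n :=
  \col_i (sep_coord x (inr (inr (t, i, true))) +i* sep_coord x (inr (inr (t, i, false)))).

Definition sep_mx (x : pt) : 'M[C]_(m * n) :=
  \sum_t (sep_wt x t)%:C *: prodproj (sep_v x t) (sep_w x t).

Definition sep_pt (c : sep_idx -> R) : pt := \row_j c (enum_val j).

Lemma sep_ptK c j : sep_coord (sep_pt c) j = c j.
Proof. by rewrite /sep_coord mxE enum_rankK. Qed.

Lemma sep_coord_cont j : continuous (sep_coord^~ j).
Proof. exact: (@coord_continuous R 1 _ 0 (enum_rank j)). Qed.

Lemma ccont_coord a b : ccont (fun x => sep_coord x a +i* sep_coord x b).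
Proof. by split; exact: sep_coord_cont. Qed.

Lemma ccont_wt t : ccont (fun x => (sep_wt x t)%:C).
Proof.
split; last by move=> x; apply: (@cst_continuous _ R 0). move=> x.
by apply: continuousM; exact: sep_coord_cont.
Qed.

Lemma mxcont_v t : mxcont (sep_v^~ t).
Proof. by move=> i j; under eq_fun do rewrite mxE; exact: ccont_coord. Qed.

Lemma mxcont_w t : mxcont (sep_w^~ t).
Proof. by move=> i j; under eq_fun do rewrite mxE; exact: ccont_coord. Qed.

Lemma mxcont_sep_mx : mxcont sep_mx.
Proof.
apply: mxcont_sum => t; apply: mxcontZ; first exact: ccont_wt.
by apply: mxcont_kron; apply: mxcontM;
  [exact: mxcont_v | exact/mxcont_adj/mxcont_v
  | exact: mxcont_w | exact/mxcont_adj/mxcont_w].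
Qed.

Definition sep_constraint (x : pt) (i : unit + ('I_K + 'I_K)) : R :=
  match i with
  | inl _ => \sum_t sep_wt x t
  | inr (inl t) => Re ((adjmx (sep_v x t) *m sep_v x t) 0 0)
  | inr (inr t) => Re ((adjmx (sep_w x t) *m sep_w x t) 0 0)
  end.

Lemma sep_constraint_cont i : continuous (sep_constraint^~ i).
Proof.
case: i => [_|[t|t]] /=.
- have [+ _] : ccont (fun x => \sum_t (sep_wt x t)%:C).
    by apply: ccont_sum => t; exact: ccont_wt.
  by under eq_fun do rewrite -rmorph_sum /=.
- by case: (mxcontM (mxcont_adj (mxcont_v t)) (mxcont_v t) 0 0).
- by case: (mxcontM (mxcont_adj (mxcont_w t)) (mxcont_w t) 0 0).
Qed.

Lemma sqnormE N (v : 'cV[C]_N) :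
  (adjmx v *m v) 0 0 = (\sum_i (Re (v i 0) ^+ 2 + Im (v i 0) ^+ 2))%:C.
Proof.
rewrite mxE rmorph_sum /=; apply: eq_bigr => i _.
by rewrite adjmxE add_Re2_Im2 normCK mulrC.
Qed.

Lemma unitvecE N (v : 'cV[C]_N) :
  unitvec v <-> \sum_i (Re (v i 0) ^+ 2 + Im (v i 0) ^+ 2) = 1.
Proof.
split=> [v1|v1]; last by rewrite /unitvec [LHS]mx11_scalar sqnormE v1.
by apply: complexI; rewrite -sqnormE v1 mxE.
Qed.

Lemma sep_constraintP (x : pt) : (forall i, sep_constraint x i = 1) <->
  [/\ \sum_t sep_wt x t = 1, forall t, unitvec (sep_v x t) &
     forall t, unitvec (sep_w x t)].
Proof.
split=> [cx|[x1 xv xw] [_|[t|t]] //=].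
- split; first exact: (cx (inl tt)).
    by move=> t; apply/unitvecE; have := cx (inr (inl t)); rewrite /= sqnormE.
  by move=> t; apply/unitvecE; have := cx (inr (inr t)); rewrite /= sqnormE.
- by rewrite xv mxE.
- by rewrite xw mxE.
Qed.

Lemma ler_sum_term (I : finType) (F : I -> R) i :
  (forall j, 0 <= F j) -> F i <= \sum_j F j.
Proof. by move=> F0; rewrite (bigD1 i)//= lerDl sumr_ge0. Qed.

Lemma sqr_le1 (a : R) : a ^+ 2 <= 1 -> `|a| <= 1.
Proof. by move=> a1; rewrite -(@expr_le1 _ 2) // real_normK ?num_real. Qed.

(** The square of each coordinate is bounded by a sum of squares that some constraint sets to 1. *)
Lemma sep_bounded (x : pt) :
  (forall i, sep_constraint x i = 1) -> forall j, `|x 0 j| <= 1.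
Proof.
move=> /sep_constraintP[x1 xv xw] j; apply: sqr_le1.
rewrite -(enum_valK j) -/(sep_coord _ _).
case: (enum_val j) => [t|[[[t i] b]|[[t i] b]]].
- rewrite -x1 -/(sep_wt x t); apply: ler_sum_term => u; exact: sqr_ge0.
- move: (xv t) => /unitvecE <-.
  apply: le_trans (ler_sum_term i _) => [|k]; last by rewrite addr_ge0 ?sqr_ge0.
  by rewrite mxE /=; case: b; rewrite ?lerDl ?lerDr ?sqr_ge0.
- move: (xw t) => /unitvecE <-.
  apply: le_trans (ler_sum_term i _) => [|k]; last by rewrite addr_ge0 ?sqr_ge0.
  by rewrite mxE /=; case: b; rewrite ?lerDl ?lerDr ?sqr_ge0.
Qed.

Lemma sep_length_param (s : 'M[C]_(m * n)) : sep_length K s <->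
  exists x, (forall i, sep_constraint x i = 1) /\ s = sep_mx x.
Proof.
split=> [[p [v [w [p0 p1 hv hw ->]]]]|[x [/sep_constraintP[x1 xv xw] ->]]]; last first.
  by exists (sep_wt x), (sep_v x), (sep_w x); split=> // t; exact: sqr_ge0.
pose c (j : sep_idx) : R := match j with
  | inl t => Num.sqrt (p t)
  | inr (inl (t, i, b)) => if b then Re (v t i 0) else Im (v t i 0)
  | inr (inr (t, i, b)) => if b then Re (w t i 0) else Im (w t i 0)
  end.
have wtE t : sep_wt (sep_pt c) t = p t by rewrite /sep_wt sep_ptK sqr_sqrtr.
have vE t : sep_v (sep_pt c) t = v t.
  by apply/colP=> i; rewrite mxE !sep_ptK /=; case: (v t i 0).
have wE t : sep_w (sep_pt c) t = w t.
  by apply/colP=> i; rewrite mxE !sep_ptK /=; case: (w t i 0).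
exists (sep_pt c); split.
  apply/sep_constraintP; split=> [|t|t]; rewrite ?vE ?wE //.
  by rewrite -p1; apply: eq_bigr => t _.
by apply: eq_bigr => t _; rewrite wtE vE wE.
Qed.

(** For Hermitian [rho] the minimized quantity is the squared Hilbert-Schmidt distance, a continuous
    function of the compact parameter set. *)
Lemma nearest_separable (rho : 'M[C]_(m * n)) :
  (exists s : 'M[C]_(m * n), sep_length K s) ->
  exists s0 : 'M[C]_(m * n), sep_length K s0 /\ forall s, sep_length K s ->
    Re (\tr ((rho - s0) *m (rho - s0))) <= Re (\tr ((rho - s) *m (rho - s))).
Proof.
move=> [s1 /sep_length_param[x1 [cx1 _]]].
pose f x := \tr ((rho - sep_mx x) *m (rho - sep_mx x)).
have [cf _] : ccont f.
  have cB : mxcont (fun x => rho - sep_mx x).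
    by apply: mxcontB mxcont_sep_mx => i j; exact: ccont_cst.
  by apply: ccont_trace; apply: mxcontM.
have [x [cx xm]] := min_on_bounded_variety cf sep_constraint_cont sep_bounded
  (ex_intro _ x1 cx1).
exists (sep_mx x); split; first by apply/sep_length_param; exists x.
by move=> s /sep_length_param[y [cy ->]]; exact: xm.
Qed.

End Parametrization.

End Compactness.

(** * Separation *)

Section Separation.
Local Open Scope complex_scope.
Variable R : realType.
Notation C := R[i].
Notation cj := (@Num.Def.conjC C).

Lemma conjC_re (x : R) : cj x%:C = x%:C.
Proof. exact: conjc_real. Qed.

Lemma hermitianB n (A B : 'M[C]_n) : hermitian A -> hermitian B -> hermitian (A - B).
Proof. by rewrite /Defs.hermitian /adjmx map_mxB linearB /= => <- <-. Qed.

Definition block_positive m n (W : 'M[C]_(m * n)) :=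
  forall (a : 'cV[C]_m) (b : 'cV[C]_n),
    0 <= (adjmx (prodvec a b) *m W *m prodvec a b) 0 0.

Lemma quad_formZ n (A : 'M[C]_n) c (v : 'cV[C]_n) :
  (adjmx (c *: v) *m A *m (c *: v)) 0 0 = `|c| ^+ 2 * (adjmx v *m A *m v) 0 0.
Proof.
rewrite adjmxZ -!scalemxAl -scalemxAr mxE [X in _ * X]mxE mulrA; congr (_ * _).
by rewrite normCK mulrC.
Qed.

Lemma prodvecZ m n c d (a : 'cV[C]_m) (b : 'cV[C]_n) :
  prodvec (c *: a) (d *: b) = (c * d) *: prodvec a b.
Proof. by apply/colP=> k; rewrite !mxE mulrACA. Qed.

(** The alternative [c = 0] covers the zero vector, which cannot be normalized. *)
Lemma unit_scale n (v : 'cV[C]_n) : exists c u,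
  v = c *: u /\ (unitvec u \/ c = 0).
Proof.
set s := \sum_i (Re (v i 0) ^+ 2 + Im (v i 0) ^+ 2).
have t0 i : 0 <= Re (v i 0) ^+ 2 + Im (v i 0) ^+ 2 by rewrite addr_ge0 ?sqr_ge0.
have s0 : 0 <= s by rewrite sumr_ge0.
have [sz|snz] := eqVneq s 0.
  exists 0, v; split; last by right.
  rewrite scale0r; apply/colP => i; rewrite mxE.
  have /(_ i isT)/eqP := psumr_eq0P (fun i _ => t0 i) sz.
  rewrite paddr_eq0 ?sqr_ge0// !sqrf_eq0; case: (v i 0) => x y /=.
  by case/andP => /eqP -> /eqP ->.
exists (Num.sqrt s)%:C, ((Num.sqrt s)^-1%:C *: v); split.
  by rewrite scalerA -rmorphM divff ?scale1r// sqrtr_eq0 -ltNge lt_def snz.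
left; rewrite /unitvec [LHS]mx11_scalar adjmxZ -scalemxAl -scalemxAr scalerA mxE sqnormE -/s.
rewrite conjC_re -!rmorphM /= -invfM -expr2 sqr_sqrtr// mulVf //.
Qed.

Lemma block_positive_unit m n (W : 'M[C]_(m * n)) :
  (forall (v : 'cV[C]_m) (w : 'cV[C]_n), unitvec v -> unitvec w ->
    0 <= \tr (W *m prodproj v w)) -> block_positive W.
Proof.
move=> Wp a b; have [c [v [-> hv]]] := unit_scale a; have [d [w [-> hw]]] := unit_scale b.
rewrite prodvecZ quad_formZ.
case: hv => [hv|->]; last by rewrite mul0r normr0 expr0n mul0r.
case: hw => [hw|->]; last by rewrite mulr0 normr0 expr0n mul0r.
rewrite mulr_ge0 ?exprn_ge0// quad_formE -kron_rank1; exact: Wp.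
Qed.

Lemma unitvec_delta n (i : 'I_n) : unitvec (delta_mx i 0 : 'cV[C]_n).
Proof.
rewrite /unitvec /adjmx map_delta_mx trmx_delta mul_delta_mx.
by apply/matrixP => x y; rewrite !ord1 !mxE.
Qed.

Lemma trace_sqr_hermitian n (A : 'M[C]_n) : hermitian A ->
  \tr (A *m A) = \sum_i \sum_j `|A i j| ^+ 2.
Proof.
move=> hA; apply: eq_bigr => i _; rewrite mxE; apply: eq_bigr => j _.
by rewrite {2}hA adjmxE normCK.
Qed.

Lemma trace_sqr_hermitian_gt0 n (A : 'M[C]_n) : hermitian A -> A != 0 ->
  0 < \tr (A *m A).
Proof.
move=> hA; rewrite lt_def trace_sqr_hermitian // => A0.
have p0 i : 0 <= \sum_j `|A i j| ^+ 2 by apply: sumr_ge0 => j _; exact: exprn_ge0.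
rewrite sumr_ge0 ?andbT//; apply: contra A0 => /eqP s0.
apply/eqP/matrixP => i j; rewrite mxE.
have /(_ i isT) si := psumr_eq0P (fun i _ => p0 i) s0.
have /(_ j isT)/eqP := psumr_eq0P (fun j _ => exprn_ge0 2 (normr_ge0 (A i j))) si.
by rewrite expf_eq0 /= normr_eq0 => /eqP.
Qed.

Lemma trace_sqr_sub n (A B : 'M[C]_n) c :
  \tr ((A - c *: B) *m (A - c *: B)) =
  \tr (A *m A) - c * (2 * \tr (A *m B)) + c * (c * \tr (B *m B)).
Proof.
rewrite mulmxBr !mulmxBl -!scalemxAl -!scalemxAr !raddfB /= !mxtraceZ.
by rewrite (mxtrace_mulC B A); ring.
Qed.

Lemma trace_hermitian_real n (A B : 'M[C]_n) :
  hermitian A -> hermitian B -> \tr (A *m B) \is Num.real.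
Proof.
move=> hA hB; apply/CrealP.
by rewrite -[LHS]mxtrace_adjmx adjmxM -hA -hB mxtrace_mulC.
Qed.

(** If a > 0, the admissible value e = a / (a + b) would give 2 (a + b) <= b. *)
Lemma small_quadratic (a b : R) : 0 <= b ->
  (forall e, 0 < e <= 1 -> a * 2 <= e * b) -> a <= 0.
Proof.
move=> b0 H; rewrite leNgt; apply/negP => a0.
have ab : 0 < a + b by rewrite ltr_wpDr.
have := H (a / (a + b)); rewrite divr_gt0 //= ler_pdivrMr// mul1r lerDl b0.
move=> /(_ isT); rewrite mulrAC ler_pdivlMr//; nra.
Qed.

Lemma sep_length_hermitian m n K (s : 'M[C]_(m * n)) :
  sep_length K s -> hermitian s /\ \tr s = 1.
Proof.
move=> [p [v [w [p0 p1 hv hw ->]]]]; split.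
  rewrite /Defs.hermitian adjmx_sum; apply: eq_bigr => t _.
  by rewrite adjmxZ -hermitian_prodproj conjC_re.
rewrite raddf_sum /=; under eq_bigr do rewrite mxtraceZ mxtrace_prodproj // mulr1.
by rewrite -rmorph_sum p1.
Qed.

(** Let [s0] be a nearest separable state and [D] = rho - s0. Minimality along the segment from [s0]
    to a product state X gives tr (D (X - s0)) <= 0. Hence W = tr (D s0) 1 - D is nonnegative on
    product states, while tr (W rho) = - tr (D D) < 0. *)
Lemma separating_witness m n (rho : 'M[C]_(m * n)) : (0 < m)%N -> (0 < n)%N ->
  hermitian rho -> \tr rho = 1 -> ~ separable rho ->
  exists W, [/\ hermitian W, block_positive W & \tr (W *m rho) < 0].
Proof.
move=> m0 n0 hrho rho1 nsep.
(* The least length for which [sep_length_pred] applies, namely the dimension of the matrix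
   space. *)
pose K := (m * n * (m * n))%N.
have K0 : (0 < K)%N by rewrite !muln_gt0 m0 n0.
have [] := @nearest_separable R m n K rho.
  (* The minimization needs one separable state: e_0 (x) e_0, with all the weight on a single
     term. *)
  exists (prodproj (delta_mx (Ordinal m0) 0) (delta_mx (Ordinal n0) 0)).
  exists (fun t => (t == Ordinal K0)%:R), (fun=> delta_mx (Ordinal m0) 0),
    (fun=> delta_mx (Ordinal n0) 0).
  split=> [t||t|t|]; rewrite ?ler0n //; do ?exact: unitvec_delta.
    by rewrite (bigD1 (Ordinal K0)) //= ?eqxx big1 ?addr0// => t /negPf ->.
  rewrite (bigD1 (Ordinal K0)) //= ?eqxx big1 ?addr0 ?scale1r// => t /negPf ->.
  by rewrite scale0r.
move=> s0 [s0K s0min]; have [hs0 s01] := sep_length_hermitian s0K.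
pose D := rho - s0.
have hD : hermitian D by exact: hermitianB.
have D0 : D != 0.
  rewrite subr_eq0; apply/eqP => E; apply: nsep; rewrite E.
  exact: sep_length_separable s0K.
have DD := trace_sqr_hermitian_gt0 hD D0.
have variation (v : 'cV[C]_m) (w : 'cV[C]_n) : unitvec v -> unitvec w ->
    Re (\tr (D *m (prodproj v w - s0))) <= 0.
  move=> hv hw; set X := prodproj v w; pose E := X - s0.
  have hE : hermitian E.
    by apply: hermitianB => //; exact: hermitian_prodproj.
  (* Expanding tr ((D - e E)^2) >= tr (D^2) gives 2 tr (D E) <= e tr (E^2) for every e in (0, 1]. *)
  apply: (@small_quadratic _ (Re (\tr (E *m E)))).
    have : 0 <= \tr (E *m E).
      rewrite trace_sqr_hermitian//; apply: sumr_ge0 => i _.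
      by apply: sumr_ge0 => j _; exact: exprn_ge0.
    by rewrite lecE => /andP[].
  move=> e /andP[e0 e1].
  have : sep_length K ((1 - e)%:C *: s0 + e%:C *: X).
    (* Appending X at index [ord_max] gives K + 1 terms, and the Caratheodory reduction returns to
       K; the segment therefore stays in the set on which [s0] is minimal. *)
    apply: sep_length_pred => //; move: s0K => [p [v' [w' [p0 p1 hv' hw' ->]]]].
    exists (fun t => if unlift ord_max t is Some u then (1 - e) * p u else e).
    exists (fun t => if unlift ord_max t is Some u then v' u else v).
    exists (fun t => if unlift ord_max t is Some u then w' u else w).
    split=> [t||t|t|]; try (by case: unliftP).
    - by case: unliftP => [u|] _; [rewrite mulr_ge0// subr_ge0|exact: ltW].
    - rewrite (bigD1_ord ord_max)//= unlift_none.
      under eq_bigr do rewrite liftK.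
      by rewrite -mulr_sumr p1; ring.
    - rewrite [RHS](bigD1_ord ord_max)//= unlift_none addrC; congr (_ + _).
      rewrite scaler_sumr; apply: eq_bigr => u _; rewrite liftK.
      by rewrite scalerA -rmorphM.
  move=> /s0min.
  have -> : rho - ((1 - e)%:C *: s0 + e%:C *: X) = D - e%:C *: E.
    rewrite rmorphB /= scalerBl scale1r scalerBr /D.
    by rewrite opprD !opprB -!addrA addrCA.
  rewrite -/D -/E trace_sqr_sub.
  move: (\tr (D *m D)) (\tr (D *m E)) (\tr (E *m E)) => [x x'] [y y'] [z z'] /=.
  nra.
pose c := \tr (D *m s0).
exists (c%:M - D); split.
- apply: hermitianB => //; rewrite -scalemx1; apply: hermitianZ.
    exact: trace_hermitian_real.
  by rewrite /Defs.hermitian /adjmx map_mx1 trmx1.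
- apply: block_positive_unit => v w hv hw.
  rewrite mulmxBl mul_scalar_mx raddfB /= mxtraceZ mxtrace_prodproj// mulr1.
  have hE : hermitian (prodproj v w - s0).
    by apply: hermitianB => //; exact: hermitian_prodproj.
  have := variation _ _ hv hw; have := trace_hermitian_real hD hE.
  rewrite mulmxBr raddfB /= -/c -[c - _]opprB oppr_ge0.
  move: (_ - _) => z; rewrite realE => /orP[|//].
  by rewrite !lecE => /andP[/eqP <- _] ->; rewrite eqxx.
- rewrite mulmxBl mul_scalar_mx raddfB /= linearZ /= rho1 mulr1.
  suff -> : c - \tr (D *m rho) = - \tr (D *m D) by rewrite oppr_lt0.
  by rewrite -opprB -raddfB -mulmxBr.
Qed.

End Separation.

(** * Transport by local filters *)

Section Transport.
Variable R : realType.
Notation C := R[i].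
Notation cj := (@Num.Def.conjC C).

Lemma witness_of_block_positive m n (W rho : 'M[C]_(m * n)) :
  hermitian W -> block_positive W -> psd rho -> \tr (W *m rho) < 0 -> ent_witness W.
Proof.
move=> hW bW prho neg; split=> //.
by have [d [v [d0 _ de]]] := trace_neg_eigenvalue hW prho neg; exists d.
Qed.

(** Moving the partial transpose from Q onto [sigma] leaves two traces of products of psd matrices.
    A PPT state with negative trace against W thus certifies that W is nondecomposable. *)
Lemma decomposable_trace_ge0 m n (W sigma : 'M[C]_(m * n)) :
  psd sigma -> psd (ptrans sigma) -> decomposable W -> 0 <= \tr (W *m sigma).
Proof.
move=> ps pts [P [Q [pP pQ ->]]].
by rewrite mulmxDl raddfD /= mxtrace_ptrans addr_ge0 ?psd_trace_ge0.
Qed.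

(** On a (x) b the form of the partial transpose equals the form of P on conj(a) (x) b. *)
Lemma block_positive_ptrans m n (P : 'M[C]_(m * n)) :
  psd P -> block_positive (ptrans P).
Proof.
move=> pP a b; rewrite quad_formE mxtrace_ptrans ptrans_rank1.
by apply: psd_trace_ge0 => //; exact: psd_rank1.
Qed.

Lemma block_positive_congr m n p q (W : 'M[C]_(p * q)) (A : 'M[C]_(p, m))
    (B : 'M[C]_(q, n)) :
  block_positive W -> block_positive (adjmx (kron A B) *m W *m kron A B).
Proof.
move=> bW a b; have := bW (A *m a) (B *m b).
by rewrite -kron_prodvec adjmxM !mulmxA.
Qed.

Lemma block_positiveD m n (V W : 'M[C]_(m * n)) :
  block_positive V -> block_positive W -> block_positive (V + W).
Proof. by move=> bV bW a b; rewrite mulmxDr mulmxDl mxE addr_ge0. Qed.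

Lemma block_positiveZ m n c (W : 'M[C]_(m * n)) :
  0 <= c -> block_positive W -> block_positive (c *: W).
Proof. by move=> c0 bW a b; rewrite -scalemxAr -scalemxAl mxE mulr_ge0. Qed.

(* A witness W detecting a PPT state sigma whose partial transpose kills
   sum_(i < r) e_i (x) e_i, the canonical vector of Schmidt rank r. *)
Definition ppt_seed p q r := exists W sigma : 'M[C]_(p * q),
  [/\ hermitian W, block_positive W, psd sigma, psd (ptrans sigma) &
      \tr (W *m sigma) < 0 /\ ptrans sigma *m vecm (pid_mx r : 'M_(p, q)) = 0].

(** A full-rank factorization of M consists of one column and one row; rank 0 gives the zero product
    vector. *)
Lemma rank_le1_prodvec m n (M : 'M[C]_(m, n)) : (\rank M <= 1)%N ->
  exists a b, vecm M = prodvec a b.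
Proof.
move: (mulmx_base M); move: (col_base M) (row_base M).
case: (\rank M) => [|[|//]] A B <- _.
  exists 0, 0; rewrite prodvecE mul0mx; congr vecm.
  by apply/matrixP => i j; rewrite !mxE big_ord0.
by exists A, B^T; rewrite prodvecE trmxK.
Qed.

(** The Gaussian normal form M = L (pid r) U provides invertible local filters that carry the seed
    to [M]. Truncation to a p x q corner caps the rank, whence the minimum in the seed. *)
Lemma nondecomposable_of_negative m n p q (rho : 'M[C]_(m * n)) (M : 'M[C]_(m, n)) :
  (p <= m)%N -> (q <= n)%N -> psd rho ->
  (adjmx (vecm M) *m ptrans rho *m vecm M) 0 0 < 0 ->
  ppt_seed p q (minn (minn p q) (\rank M)) ->
  exists W : 'M[C]_(m * n), [/\ ent_witness W, ~ decomposable W & \tr (W *m rho) < 0].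
Proof.
move=> pm qn prho neg [W1 [s [hW1 bW1 ps pts [W1s sM]]]].
set r := \rank M in sM; set L := col_ebase M; set U := row_ebase M.
have Lu : L \in unitmx by exact: col_ebase_unit.
have Uu : U \in unitmx by exact: row_ebase_unit.
have pidpm : pid_mx p *m (pid_mx p : 'M_(m, p)) = 1%:M :> 'M[C]_p.
  by rewrite mul_pid_mx minnn (minn_idPr pm) pid_mx_1.
have pidqn : pid_mx q *m (pid_mx q : 'M_(n, q)) = 1%:M :> 'M[C]_q.
  by rewrite mul_pid_mx minnn (minn_idPr qn) pid_mx_1.
(* The partial transpose of the transported state involves conj(G) (x) H, whose adjoint sends
   [vecm M] to the vectorization of pid_p L^-1 M U^-1 pid_q, the vector killed by the seed. [A] and
   [B] are left inverses of [G] and [H], and pull the witness of the seed back to m x n. *)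
pose G : 'M[C]_(m, p) := (pid_mx p *m invmx L)^T.
pose H : 'M[C]_(n, q) := map_mx cj (invmx U *m pid_mx q).
pose A : 'M[C]_(p, m) := (L *m pid_mx p)^T.
pose B : 'M[C]_(q, n) := map_mx cj (pid_mx q *m U).
have AG : A *m G = 1%:M.
  by rewrite /A /G -trmx_mul mulmxA mulmxKV// pidpm trmx1.
have BH : B *m H = 1%:M.
  by rewrite /B /H -map_mxM mulmxA mulmxK// pidqn map_mx1.
pose sig := kron G H *m s *m adjmx (kron G H).
have sigP : psd sig by exact: psd_congr.
have sigTE : ptrans sig =
    kron (map_mx cj G) H *m ptrans s *m adjmx (kron (map_mx cj G) H).
  exact: ptrans_congr.
have sigTP : psd (ptrans sig) by rewrite sigTE; exact: psd_congr.
have sigM : ptrans sig *m vecm M = 0.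
  rewrite sigTE adjmx_kron -mulmxA kron_vecm.
  suff -> : adjmx (map_mx cj G) *m M *m (adjmx H)^T = pid_mx (minn (minn p q) r).
    by rewrite -mulmxA sM mulmx0.
  rewrite /adjmx /H -!map_mx_comp !(map_mx_id (@conjCK _)) !trmxK.
  rewrite -{1}(mulmx_ebase M) -/L -/U -/r !mulmxA mulmxKV// mulmxK//.
  rewrite !mul_pid_mx; congr pid_mx; lia.
pose V := adjmx (kron A B) *m W1 *m kron A B.
have hV : hermitian V by rewrite /V -{2}(adjmxK (kron A B)); exact: hermitian_congr.
have bV : block_positive V by exact: block_positive_congr.
have Vsig : \tr (V *m sig) < 0.
  rewrite /V /sig -!mulmxA mxtrace_mulC -!mulmxA -adjmxM kronM AG BH kron1.
  rewrite /adjmx map_mx1 trmx1 mulmx1 !mulmxA -(mulmxA W1) kronM AG BH kron1 mulmx1.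
  exact: W1s.
pose N := vecm M *m adjmx (vecm M).
have pN : psd N by exact: psd_rank1.
have hN : hermitian (ptrans N) by apply: hermitian_ptrans; case: pN.
set x := (_ 0 0) in neg; set y := \tr (V *m rho).
have yr : y \is Num.real by apply: trace_hermitian_real => //; case: prho.
(* With this choice t * x = - (|y| + 1), which outweighs [y]. *)
pose t := (`|y| + 1) / - x.
have t0 : 0 < t by rewrite divr_gt0 ?oppr_gt0// ltr_wpDl.
pose W := t *: ptrans N + V.
have hW : hermitian W.
  by apply: hermitianD => //; apply: hermitianZ => //; exact: gtr0_real.
have bW : block_positive W.
  apply: block_positiveD => //; apply: block_positiveZ; first exact: ltW.
  exact: block_positive_ptrans.
have xE : \tr (ptrans N *m rho) = x.
  by rewrite mxtrace_ptrans mxtrace_mulC /x quad_formE.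
have Wrho : \tr (W *m rho) < 0.
  rewrite mulmxDl -scalemxAl raddfD /= mxtraceZ xE -/y.
  have -> : t * x = - (`|y| + 1) by rewrite /t invrN mulrN mulNr divfK// lt_eqF.
  rewrite opprD addrAC -subr_lt0 subr0 -oppr_gt0 !opprD !opprK.
  by rewrite ltr_wpDl// subr_ge0 real_ler_norm.
exists W; split=> //; first exact: witness_of_block_positive Wrho.
(* Against [sig] the first summand of [W] contributes tr (N sig^Gamma) = 0, so only tr (V sig) < 0
   remains. *)
move=> /(decomposable_trace_ge0 sigP sigTP); apply/negP; rewrite -real_ltNge ?real0//.
  rewrite mulmxDl -scalemxAl raddfD /= mxtraceZ mxtrace_ptrans mxtrace_mulC /N mulmxA.
  by rewrite sigM mul0mx mxtrace0 mulr0 add0r.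
by apply: trace_hermitian_real => //; case: sigP.
Qed.

Lemma nondecomposable_witness m n (rho : 'M[C]_(m * n)) :
  (forall r, (1 < r <= 3)%N -> ppt_seed 3 3 r) -> ppt_seed 2 4 2 -> ppt_seed 4 2 2 ->
  (0 < m)%N -> (0 < n)%N -> (6 < m * n)%N -> entangled rho ->
  exists W : 'M[C]_(m * n), [/\ ent_witness W, ~ decomposable W & \tr (W *m rho) < 0].
Proof.
move=> seed33 seed24 seed42 m0 n0 mn [[prho rho1] nsep]; have [hrho _] := prho.
have [W [hW bW Wrho]] := separating_witness m0 n0 hrho rho1 nsep.
have eW := witness_of_block_positive hW bW prho Wrho.
have [[P [Q [pP pQ WE]]]|] := pselect (decomposable W); last by exists W.
have Qrho : \tr (ptrans rho *m Q) < 0.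
  move: Wrho; rewrite WE mulmxDl raddfD /= mxtrace_ptrans (mxtrace_mulC Q).
  by apply: le_lt_trans; rewrite lerDr psd_trace_ge0.
have [d [v [d0 dE _]]] := trace_neg_eigenvalue (hermitian_ptrans hrho) pQ Qrho.
have := d0; rewrite dE -(unvecmK v); move: (unvecm v) => M neg.
(* Since [rho] is psd, its partial transpose is nonnegative on product vectors. *)
have r1 : (1 < \rank M)%N.
  rewrite ltnNge; apply/negP => /rank_le1_prodvec[a [b ME]].
  suff : 0 <= (adjmx (vecm M) *m ptrans rho *m vecm M) 0 0.
    by move=> /le_lt_trans/(_ neg); rewrite ltxx.
  by rewrite ME; exact: block_positive_ptrans.
have rm := rank_leq_row M; have rn := rank_leq_col M.
have [/andP[m3 n3]|] := boolP ((3 <= m) && (3 <= n))%N.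
  by apply: (nondecomposable_of_negative m3 n3 prho neg); apply: seed33; lia.
rewrite negb_and -!ltnNge => /orP[m3|n3].
  have m2 : (2 <= m)%N by lia.
  have n4 : (4 <= n)%N by nia.
  apply: (nondecomposable_of_negative m2 n4 prho neg).
  by have -> : minn (minn 2 4) (\rank M) = 2%N by lia.
have n2 : (2 <= n)%N by lia.
have m4 : (4 <= m)%N by nia.
apply: (nondecomposable_of_negative m4 n2 prho neg).
by have -> : minn (minn 4 2) (\rank M) = 2%N by lia.
Qed.

End Transport.

(** * Range criterion *)

Section RangeCriterion.
Variable R : realType.
Notation C := R[i].
Notation cj := (@Num.Def.conjC C).

Definition mxdot p q (Z W : 'M[C]_(p, q)) := (adjmx (vecm Z) *m vecm W) 0 0.

Lemma mxdotE p q (Z W : 'M[C]_(p, q)) :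
  mxdot Z W = \sum_i \sum_j cj (Z i j) * W i j.
Proof.
rewrite /mxdot mxE sum_pidx; apply: eq_bigr => i _; apply: eq_bigr => j _.
by rewrite adjmxE !mxE pidxK.
Qed.

(** An unnormalized state whose range is spanned by the vectors of [ws]. *)
Definition gram p q (ws : seq 'M[C]_(p, q)) : 'M[C]_(p * q) :=
  \sum_(w <- ws) vecm w *m adjmx (vecm w).

Lemma quad_form_sum N I (r : seq I) (F : I -> 'M[C]_N) (z : 'cV[C]_N) :
  (adjmx z *m (\sum_(i <- r) F i) *m z) 0 0 =
  \sum_(i <- r) (adjmx z *m F i *m z) 0 0.
Proof. by rewrite mulmx_sumr mulmx_suml summxE. Qed.

Lemma psd_gram p q (ws : seq 'M[C]_(p, q)) : psd (gram ws).
Proof. by apply: psd_sum => w; exact: psd_rank1. Qed.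

Lemma gram_kernel p q (ws : seq 'M[C]_(p, q)) Z :
  (forall w, w \in ws -> mxdot Z w = 0) ->
  (adjmx (vecm Z) *m gram ws *m vecm Z) 0 0 = 0.
Proof.
move=> Zw; rewrite quad_form_sum big_seq big1 // => w /Zw Zw0.
by rewrite quad_form_rank1 -/(mxdot Z w) Zw0 normr0 expr0n.
Qed.

(** The product vector of a term of nonzero weight lies in the range of the state. Conjugating the
    first factors decomposes the partial transpose, so the partially conjugated vector lies in its
    range. Membership in a range is phrased as orthogonality to every kernel vector [Z]. *)
Lemma range_criterion p q (ws us : seq 'M[C]_(p, q)) c :
  ptrans (gram ws) = gram us -> separable (c *: gram ws) ->
  exists (a : 'cV[C]_p) (b : 'cV[C]_q), [/\ a != 0, b != 0,
    forall Z, (forall w, w \in ws -> mxdot Z w = 0) -> mxdot Z (a *m b^T) = 0 &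
    forall Z, (forall u, u \in us -> mxdot Z u = 0) ->
      mxdot Z (map_mx cj a *m b^T) = 0].
Proof.
move=> wsus [K [pr [v [w [p0 p1 hv hw E]]]]].
have [t pt|pz] := pickP (fun t => pr t != 0); last first.
  have := oner_neq0 C; rewrite -p1 big1 ?eqxx// => t _.
  by move: (pz t) => /negbFE/eqP.
(* The form of X at y is a sum of nonnegative terms, so when it vanishes y is orthogonal to every z
   of nonzero weight. This is applied to the state and to its partial transpose. *)
have key (X : 'M[C]_(p * q)) (z : 'I_K -> 'cV[C]_(p * q)) (y : 'cV[C]_(p * q)) :
    X = \sum_t pr t *: (z t *m adjmx (z t)) -> (adjmx y *m X *m y) 0 0 = 0 ->
    (adjmx y *m z t) 0 0 = 0.
  move=> ->; rewrite quad_form_sum => s0.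
  have qE u : (adjmx y *m (pr u *: (z u *m adjmx (z u))) *m y) 0 0 =
      pr u * `|(adjmx y *m z u) 0 0| ^+ 2.
    by rewrite -scalemxAr -scalemxAl mxE quad_form_rank1.
  have q0 u : 0 <= (adjmx y *m (pr u *: (z u *m adjmx (z u))) *m y) 0 0.
    by rewrite qE mulr_ge0 ?exprn_ge0.
  have /(_ t isT)/eqP := psumr_eq0P (fun u _ => q0 u) s0.
  by rewrite qE mulf_eq0 (negPf pt) /= expf_eq0 /= normr_eq0 => /eqP.
have neq0 N (x : 'cV[C]_N) : adjmx x *m x = 1%:M -> x != 0.
  move=> x1; apply/eqP => x0; move: x1; rewrite x0 mulmx0 => /matrixP/(_ 0 0).
  by rewrite !mxE eqxx => /eqP; rewrite eq_sym oner_eq0.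
exists (v t), (w t); split; [exact: neq0|exact: neq0| |] => Z Zk.
  rewrite /mxdot -prodvecE.
  refine (key (c *: gram ws) (fun t => prodvec (v t) (w t)) _ _ _).
    by rewrite E; apply: eq_bigr => u _; rewrite kron_rank1.
  by rewrite -scalemxAr -scalemxAl mxE gram_kernel ?mulr0.
rewrite /mxdot -prodvecE.
refine (key (c *: gram us) (fun t => prodvec (map_mx cj (v t)) (w t)) _ _ _).
  rewrite -wsus -ptransZ E; apply/matrixP => k l; rewrite mxE !summxE.
  apply: eq_bigr => u _; rewrite -ptrans_rank1 kron_rank1 mxE [RHS]mxE.
  by rewrite [in RHS]mxE.
by rewrite -scalemxAr -scalemxAl mxE gram_kernel ?mulr0.
Qed.

(** The partial transpose is itself a Gram matrix, hence psd. The range criterion makes the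
    normalized state entangled, and [separating_witness] then supplies W. *)
Lemma ppt_seed_of_gram p q r (ws us : seq 'M[C]_(p, q)) :
  (0 < p)%N -> (0 < q)%N -> ptrans (gram ws) = gram us ->
  0 < \sum_(w <- ws) mxdot w w ->
  (forall u, u \in us -> mxdot u (pid_mx r) = 0) ->
  (forall (a : 'cV[C]_p) (b : 'cV[C]_q), a != 0 -> b != 0 ->
    (forall Z, (forall w, w \in ws -> mxdot Z w = 0) -> mxdot Z (a *m b^T) = 0) ->
    (forall Z, (forall u, u \in us -> mxdot Z u = 0) ->
      mxdot Z (map_mx cj a *m b^T) = 0) -> False) ->
  ppt_seed R p q r.
Proof.
move=> p0 q0 wsus trw uker norange.
have trE : \tr (gram ws) = \sum_(w <- ws) mxdot w w.
  rewrite raddf_sum /=; apply: eq_bigr => w _.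
  by rewrite mxtrace_mulC /mxdot trace_mx11.
pose c := (\tr (gram ws))^-1.
have tr0 : 0 < \tr (gram ws) by rewrite trE.
have c0 : 0 < c by rewrite invr_gt0.
have [hg _] := psd_gram ws.
have hs : hermitian (c *: gram ws) by apply: hermitianZ => //; exact: gtr0_real.
have [W [hW bW]] : exists W, [/\ hermitian W, block_positive W &
    \tr (W *m (c *: gram ws)) < 0].
  apply: separating_witness => //; first by rewrite mxtraceZ mulVf// gt_eqF.
  by move=> /(range_criterion wsus)[a [b [a0 b0 Ha Hb]]]; exact: (norange a b).
rewrite -scalemxAr mxtraceZ pmulr_rlt0// => Wg.
exists W, (gram ws); split=> //; first exact: psd_gram.
  by rewrite wsus; exact: psd_gram.
split=> //; rewrite wsus mulmx_suml big_seq big1// => u /uker ud.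
by rewrite -mulmxA [adjmx _ *m _]mx11_scalar -/(mxdot _ _) ud raddf0 mulmx0.
Qed.

End RangeCriterion.

(** * Integer certificates checked by evaluation *)

Section IntegerData.
Variable R : realType.
Notation C := R[i].
Notation cj := (@Num.Def.conjC C).

Definition entry (t : seq (seq int)) i j : int := nth 0 (nth [::] t i) j.

Definition intmx p q t : 'M[C]_(p, q) := \matrix_(i, j) (entry t i j)%:~R.

Fixpoint zsum (F : nat -> int) n : int := if n is k.+1 then zsum F k + F k else 0.

Lemma zsumE (F : nat -> int) n : \sum_(i < n) (F i)%:~R = (zsum F n)%:~R :> C.
Proof. by elim: n => [|n IH]; rewrite ?big_ord0// big_ord_recr /= IH intrD. Qed.

Definition zdot p q (F G : nat -> nat -> int) :=
  zsum (fun i => zsum (fun j => F i j * G i j) q) p.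

Definition zgram (ts : seq (seq (seq int))) i j i' j' : int :=
  foldr (fun t s => entry t i j * entry t i' j' + s) 0 ts.

Definition zpid r i j : int := ((i == j) && (i < r)%N)%:Z.

Lemma mxdot_int p q (F G : nat -> nat -> int) (A B : 'M[C]_(p, q)) :
  (forall i j, A i j = (F i j)%:~R) -> (forall i j, B i j = (G i j)%:~R) ->
  mxdot A B = (zdot p q F G)%:~R.
Proof.
move=> AF BG; rewrite mxdotE -zsumE; apply: eq_bigr => i _.
rewrite -zsumE; apply: eq_bigr => j _.
by rewrite AF BG rmorph_int intrM.
Qed.

(** The finite part of the hypotheses of [ppt_seed_of_gram], as a closed boolean; [zs] and [ys] are
    kernel vectors of the state and of its partial transpose. *)
Definition zcheck p q r (ws us zs ys : seq (seq (seq int))) : bool :=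
  let P := iota 0 p in let Q := iota 0 q in
  [&& all (fun i => all (fun j => all (fun i' => all (fun j' =>
        zgram ws i' j i j' == zgram us i j i' j') Q) P) Q) P,
      all (fun z => all (fun w => zdot p q (entry z) (entry w) == 0) ws) zs,
      all (fun y => all (fun u => zdot p q (entry y) (entry u) == 0) us) ys,
      all (fun u => zdot p q (entry u) (zpid r) == 0) us &
      0 < foldr (fun w s => zdot p q (entry w) (entry w) + s) 0 ws].

(** Each kernel vector yields one bilinear equation in the factors of a product vector. The factors
    are functions on [nat], so that for concrete sizes the sums unfold into explicit polynomials. *)
Lemma ppt_seed_of_int p q r (ws us zs ys : seq (seq (seq int))) :
  (0 < p)%N -> (0 < q)%N -> zcheck p q r ws us zs ys ->
  (forall f g : nat -> C,
    (forall z, z \in zs ->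
      \sum_(i < p) \sum_(j < q) (entry z i j)%:~R * (f i * g j) = 0) ->
    (forall y, y \in ys ->
      \sum_(i < p) \sum_(j < q) (entry y i j)%:~R * (cj (f i) * g j) = 0) ->
    forall i j, (i < p)%N -> (j < q)%N -> f i * g j = 0) ->
  ppt_seed R p q r.
Proof.
move=> p0 q0 /and5P[Hg Hz Hy Hu Hp] norange.
have intmxE t i j : intmx p q t i j = (entry t i j)%:~R by rewrite mxE.
have pidE i j : (pid_mx r : 'M[C]_(p, q)) i j = (zpid r i j)%:~R.
  by rewrite mxE /zpid; case: (_ && _).
apply: (@ppt_seed_of_gram _ p q r (map (intmx p q) ws) (map (intmx p q) us)) => //.
- have gramE T i j i' j' : gram (map (intmx p q) T) (mxvec_index i j) (mxvec_index i' j') =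
      (zgram T i j i' j')%:~R.
    rewrite /gram summxE big_map; elim: T => [|t T IH]; first by rewrite big_nil.
    rewrite big_cons IH /= intrD; congr (_ + _).
    by rewrite mxE big_ord1 adjmxE !mxE !pidxK /= rmorph_int intrM.
  apply: eq_mx_pidx => i j i' j'; rewrite ptransE !gramE; congr (_%:~R); apply/eqP.
  have mem n (k : 'I_n) : (k : nat) \in iota 0 n by rewrite mem_iota ltn_ord.
  by move: Hg => /allP/(_ _ (mem _ i))/allP/(_ _ (mem _ j))/allP/(_ _ (mem _ i'))
    /allP/(_ _ (mem _ j')).
- have -> : \sum_(w <- map (intmx p q) ws) mxdot w w =
     (foldr (fun w s => zdot p q (entry w) (entry w) + s) 0 ws)%:~R.
    rewrite big_map; elim: (ws) => [|w T IH]; first by rewrite big_nil.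
    by rewrite big_cons IH /= intrD (mxdot_int (intmxE w) (intmxE w)).
  by rewrite ltr0z.
- move=> _ /mapP[u uus ->]; rewrite (mxdot_int (intmxE u) pidE).
  by move/allP/(_ _ uus)/eqP: Hu => ->.
- move=> a b a0 b0 Ha Hb.
  have [i0 ai0] : exists i, a i 0 != 0 by apply/cV0Pn.
  have [j0 bj0] : exists j, b j 0 != 0 by apply/cV0Pn.
  (* [f] and [g] extend the vectors by 0 outside their index range. *)
  pose f k := oapp (fun i : 'I_p => a i 0) 0 (insub k).
  pose g k := oapp (fun i : 'I_q => b i 0) 0 (insub k).
  have fE (i : 'I_p) : f i = a i 0 by rewrite /f valK.
  have gE (i : 'I_q) : g i = b i 0 by rewrite /g valK.
  suff : f i0 * g j0 = 0 by move/eqP; rewrite fE gE mulf_eq0 (negPf ai0) (negPf bj0).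
  apply: norange => // [z zz|y yy].
    have : mxdot (intmx p q z) (a *m b^T) = 0.
      apply: Ha => _ /mapP[w wws ->]; rewrite (mxdot_int (intmxE z) (intmxE w)).
      by move/allP/(_ _ zz)/allP/(_ _ wws)/eqP: Hz => ->.
    rewrite mxdotE => E; rewrite -[RHS]E; apply: eq_bigr => i _; apply: eq_bigr => j _.
    by rewrite intmxE rmorph_int mxE big_ord1 fE gE !mxE.
  have : mxdot (intmx p q y) (map_mx cj a *m b^T) = 0.
    apply: Hb => _ /mapP[u uus ->]; rewrite (mxdot_int (intmxE y) (intmxE u)).
    by move/allP/(_ _ yy)/allP/(_ _ uus)/eqP: Hy => ->.
  rewrite mxdotE => E; rewrite -[RHS]E; apply: eq_bigr => i _; apply: eq_bigr => j _.
  by rewrite intmxE rmorph_int mxE big_ord1 fE gE !mxE.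
Qed.

End IntegerData.

(** * The small PPT entangled states *)

Section Seeds.
Variable R : realType.
Notation C := R[i].
Notation cj := (@Num.Def.conjC C).

Lemma mulf_cancel (F : fieldType) (x y : F) : x != 0 -> x * y = 0 -> y = 0.
Proof. by move=> x0 /eqP; rewrite mulf_eq0 (negPf x0) => /eqP. Qed.

(** The first three equations each kill a factor, which gives eight cases. Either all v or all w
    vanish, or just two products are left, and the last two equations determine them. *)
Lemma range_eqs_3x3 (F : numFieldType) (v w : nat -> F) :
  v 0 * w 0 = 0 -> v 1 * w 1 = 0 -> v 2 * w 2 = 0 ->
  - (v 0 * w 1) + v 0 * w 2 - v 1 * w 0 + 2 * (v 1 * w 2) - v 2 * w 0 = 0 ->
  - (v 0 * w 1) + v 1 * w 0 - v 1 * w 2 + 2 * (v 2 * w 0) - v 2 * w 1 = 0 ->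
  forall i j, (i < 3)%N -> (j < 3)%N -> v i * w j = 0.
Proof.
have zero_or (x y : F) : x * y = 0 -> x = 0 \/ y = 0.
  by move/eqP; rewrite mulf_eq0 => /orP[] /eqP; [left|right].
have lin (a b : F) (x e1 e2 : F) : e1 = 0 -> e2 = 0 -> x = a * e1 + b * e2 -> x = 0.
  by move=> -> -> ->; rewrite !mulr0 addr0.
move=> /zero_or z0 /zero_or z1 /zero_or z2 e1 e2.
suff : [/\ v 0 * w 1 = 0, v 0 * w 2 = 0 & v 1 * w 0 = 0] /\
       [/\ v 1 * w 2 = 0, v 2 * w 0 = 0 & v 2 * w 1 = 0].
  move=> [[? ? ?] [? ? ?]] [|[|[|//]]] [|[|[|//]]] _ _ //;
  by [case: z0 => ->; ring|case: z1 => ->; ring|case: z2 => ->; ring].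
(* The two remaining products satisfy a unimodular integer system; the nonzero coefficient pairs
   tried below are the rows of its inverses over the six mixed cases. *)
move: e1 e2; case: z0 => ->; case: z1 => ->; case: z2 => -> e1 e2;
  split; split;
  first [ by apply: (lin 0 0 _ _ _ e1 e2); ring | by apply: (lin (-1) 0 _ _ _ e1 e2); ring
        | by apply: (lin 0 (-1) _ _ _ e1 e2); ring | by apply: (lin 1 (-1) _ _ _ e1 e2); ring
        | by apply: (lin 1 1 _ _ _ e1 e2); ring | by apply: (lin 1 2 _ _ _ e1 e2); ring
        | by apply: (lin (-2) (-1) _ _ _ e1 e2); ring ].
Qed.

(** Here c stands for the conjugate of v, of which only the common vanishing matters. If v1 is
    nonzero, the ratios t = v0 / v1 and u = c0 / c1 remain, and the first three equations express w
    through t and w 3. If w 3 is nonzero, [e2] gives t = 0 or u t = 1: the former turns [e3] into 16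
    = 0, the latter turns [e1] into 3 u = 0. *)
Lemma range_eqs_2x4 (F : fieldType) (v0 v1 c0 c1 : F) (w : nat -> F) :
  2 != 0 :> F -> 3 != 0 :> F -> 5 != 0 :> F -> (v0 == 0) = (c0 == 0) ->
  (v1 == 0) = (c1 == 0) ->
  v0 * w 2 + v1 * w 1 = 0 -> v0 * w 3 + v1 * w 2 = 0 ->
  5 * (v0 * w 1) + 5 * (v1 * w 0) - 3 * (v1 * w 3) = 0 ->
  c0 * w 0 + c1 * w 1 = 0 -> c0 * w 1 + c1 * w 2 = 0 ->
  5 * (c0 * w 2) - 3 * (c1 * w 0) + 5 * (c1 * w 3) = 0 ->
  (v0 = 0 /\ v1 = 0) \/ forall j, (j < 4)%N -> w j = 0.
Proof.
move=> n2 n3 n5 vc0 vc1 A1 A2 A3 B1 B2 B3.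
have [v1z|v1n] := eqVneq v1 0.
  have [v0z|v0n] := eqVneq v0 0; first by left.
  right; have c1z : c1 = 0 by apply/eqP; rewrite -vc1 v1z.
  have c0n : c0 != 0 by rewrite -vc0.
  move: A1 A2 B1 B2; rewrite v1z c1z !mul0r !addr0.
  by move=> /(mulf_cancel v0n) ? /(mulf_cancel v0n) ? /(mulf_cancel c0n) ?
    /(mulf_cancel c0n) ? [|[|[|[|//]]]].
right; have c1n : c1 != 0 by rewrite -vc1.
pose t := v0 / v1; pose u := c0 / c1.
have vE : v0 = t * v1 by rewrite /t divfK.
have cE : c0 = u * c1 by rewrite /u divfK.
have w2 : w 2 = - t * w 3.
  by apply/eqP; rewrite -subr_eq0; apply/eqP/(mulf_cancel v1n); rewrite -A2 vE; ring.
have w1 : w 1 = t ^+ 2 * w 3.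
  apply/eqP; rewrite -subr_eq0; apply/eqP/(mulf_cancel v1n).
  by rewrite -A1 vE w2; ring.
have w0 : 5 * w 0 = (3 - 5 * t ^+ 3) * w 3.
  apply/eqP; rewrite -subr_eq0; apply/eqP/(mulf_cancel v1n).
  by rewrite -A3 vE w1; ring.
have [w3|w3n] := eqVneq (w 3) 0.
  have w0z : w 0 = 0 by apply: (mulf_cancel n5); rewrite w0 w3 mulr0.
  by move=> [|[|[|[|//]]]] _ //; rewrite ?w1 ?w2 w3 mulr0.
have e1 : u * (3 - 5 * t ^+ 3) + 5 * t ^+ 2 = 0.
  apply/(mulf_cancel w3n)/(mulf_cancel c1n).
  transitivity (5 * (c0 * w 0 + c1 * w 1)); last by rewrite B1 mulr0.
  by rewrite cE w1; transitivity (u * c1 * (5 * w 0) + 5 * c1 * (t ^+ 2 * w 3));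
    [rewrite w0|]; ring.
have e2 : t * (u * t - 1) = 0.
  by apply/(mulf_cancel w3n)/(mulf_cancel c1n); rewrite -B2 cE w1 w2; ring.
have e3 : 16 - 25 * (u * t) + 15 * t ^+ 3 = 0.
  apply/(mulf_cancel w3n)/(mulf_cancel c1n).
  transitivity (5 * (5 * (c0 * w 2) - 3 * (c1 * w 0) + 5 * (c1 * w 3))); last first.
    by rewrite B3 mulr0.
  rewrite cE w2.
  by transitivity (25 * (u * c1 * (- t * w 3)) - 3 * c1 * (5 * w 0) + 25 * (c1 * w 3));
    [rewrite w0|]; ring.
move/eqP: e2; rewrite mulf_eq0 subr_eq0 => /orP[/eqP t0|/eqP ut].
  move: e3; rewrite t0 expr0n !mulr0 subr0 addr0 => /eqP.
  have -> : 16 = 2 ^+ 4 :> F by ring.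
  by rewrite expf_eq0 /= (negPf n2).
have u0 : u = 0.
  apply: (mulf_cancel n3); rewrite -e1.
  transitivity (3 * u - 5 * (u * t) * t ^+ 2 + 5 * t ^+ 2); [rewrite ut|]; ring.
by move/eqP: ut; rewrite u0 mul0r eq_sym oner_eq0.
Qed.

(* The resulting sigma is supported on the off-diagonal e_i (x) e_j, where it is
   a 6-cycle linking positions that share a row or a column, so sigma^Gamma = sigma.
   It is locally equivalent to the state of the Tiles unextendible product basis. *)
Definition hexagon_vectors : seq (seq (seq int)) :=
  [:: [:: [:: 0; 1; 1]; [:: 0; 0; 0]; [:: 0; -1; 0]];
      [:: [:: 0; 0; -1]; [:: 1; 0; 1]; [:: 0; 0; 0]];
      [:: [:: 0; 0; 0]; [:: -1; 0; 0]; [:: 1; 1; 0]];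
      [:: [:: 0; 0; 1]; [:: 1; 0; 0]; [:: 0; 1; 0]]].

(** The three diagonal positions outside the support, then two vectors inside it; together they span
    the orthogonal complement of the four vectors above. *)
Definition hexagon_kernel : seq (seq (seq int)) :=
  [:: [:: [:: 1; 0; 0]; [:: 0; 0; 0]; [:: 0; 0; 0]];
      [:: [:: 0; 0; 0]; [:: 0; 1; 0]; [:: 0; 0; 0]];
      [:: [:: 0; 0; 0]; [:: 0; 0; 0]; [:: 0; 0; 1]];
      [:: [:: 0; -1; 1]; [:: -1; 0; 2]; [:: -1; 0; 0]];
      [:: [:: 0; -1; 0]; [:: 1; 0; -1]; [:: 2; -1; 0]]].

(** One state serves both ranks, since it lives off the diagonal while [pid_mx r] is diagonal. It
    equals its partial transpose, and its own kernel equations exclude product vectors, so the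
    second kernel list is empty. *)
Lemma hexagon_seed r : (1 < r <= 3)%N -> ppt_seed R 3 3 r.
Proof.
move=> r23.
apply: (@ppt_seed_of_int _ 3 3 r hexagon_vectors hexagon_vectors hexagon_kernel [::])
  => // f g Hz _ i j.
move: i j; apply: range_eqs_3x3.
- by rewrite -[RHS](Hz (nth [::] hexagon_kernel 0) isT)
    !big_ord_recr !big_ord0 /= /entry /=; ring.
- by rewrite -[RHS](Hz (nth [::] hexagon_kernel 1) isT)
    !big_ord_recr !big_ord0 /= /entry /=; ring.
- by rewrite -[RHS](Hz (nth [::] hexagon_kernel 2) isT)
    !big_ord_recr !big_ord0 /= /entry /=; ring.
- by rewrite -[RHS](Hz (nth [::] hexagon_kernel 3) isT)
    !big_ord_recr !big_ord0 /= /entry /=; ring.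
- by rewrite -[RHS](Hz (nth [::] hexagon_kernel 4) isT)
    !big_ord_recr !big_ord0 /= /entry /=; ring.
Qed.

(* The partial transpose of Horodecki's 2x4 state at b = 8/17 (where
   sqrt (1 - b^2) is rational), up to scaling and the sign of e_1. *)
Definition horodecki_vectors : seq (seq (seq int)) :=
  [:: [:: [:: 0; 0; 4; 0]; [:: 0; -4; 0; 0]];
      [:: [:: 0; 0; 0; 4]; [:: 0; 0; -4; 0]];
      [:: [:: 4; 0; 0; 0]; [:: 0; 0; 0; 0]];
      [:: [:: 0; 4; 0; 0]; [:: -4; 0; 0; 0]];
      [:: [:: 0; 0; 0; 0]; [:: 3; 0; 0; 5]]].

Definition horodecki_kernel : seq (seq (seq int)) :=
  [:: [:: [:: 0; 0; 1; 0]; [:: 0; 1; 0; 0]];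
      [:: [:: 0; 0; 0; 1]; [:: 0; 0; 1; 0]];
      [:: [:: 0; 5; 0; 0]; [:: 5; 0; 0; -3]]].

Definition horodecki_pt_vectors : seq (seq (seq int)) :=
  [:: [:: [:: 4; 0; 0; 0]; [:: 0; -4; 0; 0]];
      [:: [:: 0; 4; 0; 0]; [:: 0; 0; -4; 0]];
      [:: [:: 0; 0; 0; 4]; [:: 0; 0; 0; 0]];
      [:: [:: 0; 0; 4; 0]; [:: 0; 0; 0; -4]];
      [:: [:: 0; 0; 0; 0]; [:: 5; 0; 0; 3]]].

Definition horodecki_pt_kernel : seq (seq (seq int)) :=
  [:: [:: [:: 1; 0; 0; 0]; [:: 0; 1; 0; 0]];
      [:: [:: 0; 1; 0; 0]; [:: 0; 0; 1; 0]];
      [:: [:: 0; 0; 5; 0]; [:: -3; 0; 0; 5]]].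

(** The chosen sign of e_1 makes the partial transpose kill e_0 (x) e_0 + e_1 (x) e_1 rather than
    the difference. *)
Lemma horodecki_seed : ppt_seed R 2 4 2.
Proof.
apply: (@ppt_seed_of_int _ 2 4 2 horodecki_vectors horodecki_pt_vectors
  horodecki_kernel horodecki_pt_kernel) => // f g Hz Hy i j i2 j4.
have [[f0 f1]|gz] : (f 0 = 0 /\ f 1 = 0) \/ forall k, (k < 4)%N -> g k = 0.
  apply: (@range_eqs_2x4 _ _ _ (cj (f 0)) (cj (f 1)));
    rewrite ?pnatr_eq0 ?conjC_eq0 //.
- by rewrite -[RHS](Hz (nth [::] horodecki_kernel 0) isT)
    !big_ord_recr !big_ord0 /= /entry /=; ring.
- by rewrite -[RHS](Hz (nth [::] horodecki_kernel 1) isT)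
    !big_ord_recr !big_ord0 /= /entry /=; ring.
- by rewrite -[RHS](Hz (nth [::] horodecki_kernel 2) isT)
    !big_ord_recr !big_ord0 /= /entry /=; ring.
- by rewrite -[RHS](Hy (nth [::] horodecki_pt_kernel 0) isT)
    !big_ord_recr !big_ord0 /= /entry /=; ring.
- by rewrite -[RHS](Hy (nth [::] horodecki_pt_kernel 1) isT)
    !big_ord_recr !big_ord0 /= /entry /=; ring.
- by rewrite -[RHS](Hy (nth [::] horodecki_pt_kernel 2) isT)
    !big_ord_recr !big_ord0 /= /entry /=; ring.
- by case: i i2 => [|[|//]] _; rewrite ?f0 ?f1 mul0r.
- by rewrite gz ?mulr0.
Qed.

Definition transpose_rows q (t : seq (seq int)) : seq (seq int) :=
  mkseq (fun j => [seq nth 0 row j | row <- t]) q.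

(** Exchanging the tensor factors transposes every data matrix. The partial transpose then acts on
    the other original factor, which gives the same result up to a full transpose, trivial on real
    symmetric matrices. *)
Lemma horodecki_transpose_seed : ppt_seed R 4 2 2.
Proof.
pose T := map (transpose_rows 4).
apply: (@ppt_seed_of_int _ 4 2 2 (T horodecki_vectors) (T horodecki_pt_vectors)
  (T horodecki_kernel) (T horodecki_pt_kernel)) => // f g Hz Hy i j i4 j2.
(* The conjugation now falls on the factor of dimension 4; conjugating the equations, whose
   coefficients are integers, moves it to the factor of dimension 2, as [range_eqs_2x4] expects. *)
have Hy' y : y \in T horodecki_pt_kernel ->
    \sum_(i < 4) \sum_(j < 2) (entry y i j)%:~R * (f i * cj (g j)) = 0.
  move=> /Hy/(congr1 cj); rewrite rmorph0 => E; rewrite -[RHS]E rmorph_sum.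
  apply: eq_bigr => k _; rewrite rmorph_sum; apply: eq_bigr => l _.
  by rewrite !rmorphM rmorph_int /= conjCK.
have [[g0 g1]|fz] : (g 0 = 0 /\ g 1 = 0) \/ forall k, (k < 4)%N -> f k = 0.
  apply: (@range_eqs_2x4 _ _ _ (cj (g 0)) (cj (g 1)));
    rewrite ?pnatr_eq0 ?conjC_eq0 //.
- by rewrite -[RHS](Hz (nth [::] (T horodecki_kernel) 0) isT)
    !big_ord_recr !big_ord0 /= /entry /=; ring.
- by rewrite -[RHS](Hz (nth [::] (T horodecki_kernel) 1) isT)
    !big_ord_recr !big_ord0 /= /entry /=; ring.
- by rewrite -[RHS](Hz (nth [::] (T horodecki_kernel) 2) isT)
    !big_ord_recr !big_ord0 /= /entry /=; ring.
- by rewrite -[RHS](Hy' (nth [::] (T horodecki_pt_kernel) 0) isT)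
    !big_ord_recr !big_ord0 /= /entry /=; ring.
- by rewrite -[RHS](Hy' (nth [::] (T horodecki_pt_kernel) 1) isT)
    !big_ord_recr !big_ord0 /= /entry /=; ring.
- by rewrite -[RHS](Hy' (nth [::] (T horodecki_pt_kernel) 2) isT)
    !big_ord_recr !big_ord0 /= /entry /=; ring.
- by case: j j2 => [|[|//]] _; rewrite ?g0 ?g1 mulr0.
- by rewrite fz ?mul0r.
Qed.

End Seeds.

Unset Implicit Arguments.

Theorem theorem3 (R : realType) (m n : nat) :
  (0 < m)%N -> (0 < n)%N -> (6 < m * n)%N ->
  forall rho : 'M[R[i]]_(m * n), entangled rho ->
  exists W : 'M[R[i]]_(m * n),
    [/\ ent_witness W, ~ decomposable W & \tr (W *m rho) < 0].
Proof.
move=> m0 n0 mn rho; apply: nondecomposable_witness => //.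
- exact: hexagon_seed.
- exact: horodecki_seed.
- exact: horodecki_transpose_seed.
Qed.
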